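(* Let $I\subset R=K[x_1,\ldots,x_n]$ be a monomial ideal of height at least two. Then there is a polynomial ring $S=R[z_1,\ldots,z_r]$, an ideal $I_{\rm pol}\subset S$, a ring $M=S/I_{\rm pol}$, where $I_{\rm pol}$ is a full weighted polarization of $I$, and two $S$-regular sequences $\underline{f}$ and $\underline{g}$ such that (a) $\underline{f}=\{z_i-x_{j_i}^{d_i}\}_{i=1}^r$ and $\underline{g}=\{z_i-x_{j_i}\}_{i=1}^r$, where $d_i\geq 2$ for all $i$, (b) $\underline{f}$ and $\underline{g}$ are $M$-regular sequences, (c) $M/(\underline{f})=R/I$ and $M/(\underline{g})=R/\mathrm{sgn}(I)$ (canonical isomorphisms induced by $z_i\mapsto x_{j_i}^{d_i}$ and $z_i\mapsto x_{j_i}$, respectively), (d) $\mathrm{ht}(I)=\mathrm{ht}(I_{\rm pol})=\mathrm{ht}(\mathrm{sgn}(I))$, and (e) $\dim(M)=\dim(R/I)+r$ and $\mathrm{depth}(M)=\mathrm{depth}(R/I)+r$.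
   Context: $K$ is a field and $R=K[x_1,\ldots,x_n]$. For $a\in\mathbb{N}^n$ (with $0\in\mathbb N$), $x^a:=x_1^{a_1}\cdots x_n^{a_n}$. A monomial ideal $I$ of a polynomial ring has a unique finite minimal set of monomial generators $G(I)=\{x^{v_1},\ldots,x^{v_q}\}$; its incidence matrix $A$ is the matrix with columns $v_1,\ldots,v_q$. $\mathrm{ht}$ denotes height. Signature: for each row $c=(c_1,\ldots,c_q)$ of $A$, list its distinct entries in ascending order $m_0<m_1<\cdots<m_r$, let $j_i$ be the index with $c_i=m_{j_i}$, and put $\mathrm{sgn}(c)=(j_1,\ldots,j_q)$. The matrix $\mathrm{sgn}(A)$ has rows $\mathrm{sgn}(c)$, with $c$ running over the rows of $A$. The signature $\mathrm{sgn}(I)$ is the ideal of $R$ generated by the monomials $x^w$ with $w$ a column of $\mathrm{sgn}(A)$. Weighted partial polarization and shift: a row of an incidence matrix is tight if its set of distinct entries is $\{0,1,\ldots,\ell\}$ for some $\ell\ge 0$. Suppose every row of the incidence matrix of a monomial ideal $I$ has a zero entry (this holds when $\mathrm{ht}(I)\geq 2$) and the row of the variable $x_k$ is not tight. Let $p\geq 0$ be the integer such that each of $0,1,\ldots,p$ occurs as the exponent of $x_k$ in some element of $G(I)$ and $p+1$ does not, and let $q_1$ be the smallest exponent of $x_k$ occurring in $G(I)$ that is larger than $p$; thus $d:=q_1-p\geq 2$. The weighted partial polarization of $I$ with respect to $x_k$, using a new variable $z$, is the monomial ideal generated by the monomials of $G(I)$ whose $x_k$-exponent is at most $p$, together with the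 monomials $z\,x_k^{e-q_1+p}u$ for all $x_k^eu\in G(I)$ with $e\geq q_1$ and $u$ not divisible by $x_k$ (i.e. $x_k^{d}$ is replaced by $z$ in these generators). The shift $I_{\rm sft}$ of $I$ with respect to $x_k$ is obtained from it by setting $z=x_k$. Full weighted polarization: a weighted polarization of $I$ is an ideal $P_r\subset R[z_1,\ldots,z_r]$ obtained by a sequence $P_0=I,P_1,\ldots,P_r$, where $P_i\subset R[z_1,\ldots,z_i]$ is the weighted partial polarization of $P_{i-1}$ with respect to some variable $x_{j_i}$ of $R$, using the new variable $z_i$ and replacing $x_{j_i}^{d_i}$ by $z_i$. Setting $z_1=x_{j_1},\ldots,z_i=x_{j_i}$ in $P_i$ gives the corresponding sequence of successive shifts of $I$. The weighted polarization is full if the corresponding sequence of shifts ends at $\mathrm{sgn}(I)$ (i.e. at $i=r$). *)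

(* Defs.v *)
From HB Require Import structures.
From mathcomp Require Import all_boot all_order all_algebra.
From mathcomp Require Import boolp classical_sets.
From mathcomp Require Import mpoly.

Set Implicit Arguments.
Unset Strict Implicit.
Unset Printing Implicit Defensive.

Import GRing.Theory.

Local Open Scope ring_scope.
Local Open Scope classical_set_scope.
Local Open Scope quotient_scope.

(* The library's [idealr A] consists of the proper ideals of [A], and          *)
(* [prime_idealr A] of its prime ideals.                                       *)

Section CommutativeAlgebra.
Variable A : comNzRingType.

Definition ideal_gen (X : set A) : set A :=
  [set a | exists2 s : seq (A * A),
     forall c, c \in s -> X c.2 & a = \sum_(c <- s) c.1 * c.2].

Definition regular_seq (s : seq A) : Prop :=
  (forall (i : nat) (a : A), (i < size s)%N ->
     ideal_gen [set` take i s] (s`_i * a) -> ideal_gen [set` take i s] a)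
  /\ ideal_gen [set` s] <> setT.

(* Only the values [P 0], ..., [P k] matter; [k] is the number of strict       *)
(* inclusions.                                                                 *)
Definition prime_chain (k : nat) (P : nat -> prime_idealr A) : Prop :=
  forall i, (i < k)%N -> [set` P i] `<` [set` P i.+1].

Definition krull_dim (d : nat) : Prop :=
  (exists P, prime_chain d P) /\ (forall k P, prime_chain k P -> (k <= d)%N).

Definition prime_height (Q : prime_idealr A) (h : nat) : Prop :=
  (exists2 P, prime_chain h P & P h =i Q) /\
  (forall k P, prime_chain k P -> P k =i Q -> (k <= h)%N).

(* A prime over [I] that has no [prime_height] has infinite height, so it does *)
(* not affect the minimum.                                                     *)
Definition height (I : idealr A) (h : nat) : Prop :=
  (exists2 Q : prime_idealr A, {subset I <= Q} & prime_height Q h) /\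
  (forall (Q : prime_idealr A) k,
     {subset I <= Q} -> prime_height Q k -> (h <= k)%N).

End CommutativeAlgebra.

(* [s] is regular on the [A]-module [A / I], on which [a] acts as              *)
(* multiplication by its class.                                                *)
Definition quot_regular_seq (A : comNzRingType) (I : idealr A) (s : seq A) : Prop :=
  regular_seq [seq \pi_{ideal_quot I} a | a <- s].


Section Polarization.
Variable K : fieldType.

(* Depth of the graded module [K[x_1..x_N] / I]: the length of its longest     *)
(* regular sequences in the irrelevant maximal ideal.                          *)
Definition depth_seq N (I : idealr {mpoly K[N]}) (s : seq {mpoly K[N]}) : Prop :=
  quot_regular_seq I s /\
  (forall a, a \in s -> ideal_gen (range (fun i : 'I_N => 'X_i)) a).

Definition quot_depth N (I : idealr {mpoly K[N]}) (d : nat) : Prop :=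
  (exists2 s, depth_seq I s & size s = d) /\
  (forall s, depth_seq I s -> (size s <= d)%N).

Definition mon_ideal N (V : set 'X_{1..N}) : set {mpoly K[N]} :=
  ideal_gen [set 'X_[v] | v in V].

Definition monomial_ideal N (I : idealr {mpoly K[N]}) : Prop :=
  exists V : set 'X_{1..N}, [set` I] = mon_ideal V.

(* [V] enumerates (the exponents of) the minimal monomial generators G(I).     *)
Definition min_gens N (I : idealr {mpoly K[N]}) (V : seq 'X_{1..N}) : Prop :=
  [/\ uniq V, [set` I] = mon_ideal [set` V]
    & forall W : seq 'X_{1..N}, {subset W <= V} ->
        [set` I] = mon_ideal [set` W] -> {subset V <= W}].

Definition incidence_mx N (V : seq 'X_{1..N}) : 'M[nat]_(N, size V) :=
  \matrix_(i, j) (tnth (in_tuple V) j) i.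

Definition entries q (c : 'rV[nat]_q) : seq nat := [seq c ord0 j | j <- enum 'I_q].

Definition sgn_row q (c : 'rV[nat]_q) : 'rV[nat]_q :=
  let m := sort leq (undup (entries c)) in \row_j index (c ord0 j) m.

Definition sgn_mx N q (A : 'M[nat]_(N, q)) : 'M[nat]_(N, q) :=
  \matrix_(i, j) sgn_row (row i A) ord0 j.

(* The choice of the enumeration of G(I) only permutes the columns.            *)
Definition is_signature N (I : idealr {mpoly K[N]}) (J : set {mpoly K[N]}) : Prop :=
  exists2 V, min_gens I V &
    J = mon_ideal
          (range (fun j => [multinom sgn_mx (incidence_mx V) i j | i < N])).

Definition tight q (c : 'rV[nat]_q) : Prop :=
  exists l : nat, entries c =i iota 0 l.+1.

(* Replaces [x_k ^ d] by the new last variable when the exponent exceeds [p].  *)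
Definition polarize_mon N (k : 'I_N) (p d : nat) (v : 'X_{1..N}) : 'X_{1..N.+1} :=
  if (v k <= p)%N then mnmwiden v
  else (U_(ord_max) + mnmwiden (v - U_(k) *+ d))%MM.

Definition partial_polarization N (I : idealr {mpoly K[N]}) (k : 'I_N) (d : nat)
    (J : idealr {mpoly K[N.+1]}) : Prop :=
  exists2 V, min_gens I V &
  let row_of i := row i (incidence_mx V) in
  let occurs e := e \in entries (row_of k) in
  [/\ forall i, 0%N \in entries (row_of i),
      ~ tight (row_of k)
    & exists p q1 : nat,
      [/\ (forall e, (e <= p)%N -> occurs e) /\ ~~ occurs p.+1,
          [/\ occurs q1, (p < q1)%N
            & forall e, occurs e -> (p < e)%N -> (q1 <= e)%N],
          d = (q1 - p)%N
        & [set` J] = mon_ideal [set polarize_mon k p d v | v in [set` V]]]].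

(* In [{mpoly K[r + n]}] the variables of indices [0, ..., n - 1] are the      *)
(* [x_i] and those of indices [n, ..., n + r - 1] are the [z_i]. With this     *)
(* order of the sum, [{mpoly K[r.+1 + n]}] is [{mpoly K[(r + n).+1]}] by       *)
(* conversion, so that [partial_polarization] adds the next variable [z].      *)
Definition xvar n r (i : 'I_n) : 'I_(r + n) := cast_ord (addnC n r) (lshift r i).
Definition zvar n r (i : 'I_r) : 'I_(r + n) := cast_ord (addnC n r) (rshift n i).

Definition weighted_polarization n (I : idealr {mpoly K[n]}) r
    (j : 'I_r -> 'I_n) (d : 'I_r -> nat) (J : idealr {mpoly K[r + n]}) : Prop :=
  exists P : forall i : nat, idealr {mpoly K[i + n]},
  [/\ P 0%N =i I,
      forall i : 'I_r,
        @partial_polarization (i + n) (P i) (xvar i (j i)) (d i) (P i.+1)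
    & P r =i J].

Definition zsubst n r (w : 'I_r -> {mpoly K[n]}) (p : {mpoly K[r + n]}) :
    {mpoly K[n]} :=
  p \mPo [tuple match split (cast_ord (addnC r n) k) with
                | inl i => 'X_i
                | inr i => w i
                end | k < r + n].

(* The last shift is obtained from [J] by setting every [z_i] to [x_(j i)].    *)
Definition full_weighted_polarization n (I : idealr {mpoly K[n]}) r
    (j : 'I_r -> 'I_n) (d : 'I_r -> nat) (J : idealr {mpoly K[r + n]}) : Prop :=
  weighted_polarization I j d J /\
  is_signature I (ideal_gen (zsubst (fun i => 'X_(j i)) @` [set` J])).

(* [M / (s) M], for [M = K[x, z] / J], is isomorphic to [K[x] / I] by the map  *)
(* induced by the substitution [z_i |-> w i].                                  *)
Definition quotient_iso n r (J : idealr {mpoly K[r + n]})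
    (s : seq {mpoly K[r + n]}) (I : idealr {mpoly K[n]})
    (w : 'I_r -> {mpoly K[n]}) : Prop :=
  exists2 F : idealr {ideal_quot J},
    [set` F] = ideal_gen [set` [seq \pi_{ideal_quot J} a | a <- s]] &
  exists2 phi : {rmorphism {ideal_quot F} -> {ideal_quot I}},
    bijective phi &
    forall p : {mpoly K[r + n]},
      phi (\pi_{ideal_quot F} (\pi_{ideal_quot J} p))
        = \pi_{ideal_quot I} (zsubst w p).

End Polarization.

(* Main.v *)
Require Import Defs.
From HB Require Import structures.
From mathcomp Require Import all_boot all_order all_algebra.
From mathcomp Require Import boolp classical_sets.
From mathcomp Require Import mpoly ring zify.

Set Implicit Arguments.
Unset Strict Implicit.
Unset Printing Implicit Defensive.

Import GRing.Theory.

Local Open Scope ring_scope.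
Local Open Scope classical_set_scope.
Local Open Scope quotient_scope.

(** Every generator [x^v] of [I] is followed through the successive weighted
    polarizations as a single monomial. The exponents of [x_k] and of the new
    variables [z_l] with [j l = k] in this monomial depend on [v k] only, never
    decrease when [v k] grows, and satisfy
      exponent of [x_k] + sum of [d l] times the exponent of [z_l] = [v k]
    ([xexp_mono], [zexp_mono], [xexp_sum]). All claims are read off from this.

    A step takes [d] from the [x_k]-exponents above a gap, so the total of the
    exponents of the [x] variables decreases and the process stops
    ([ex_full_steps]). Between consecutive values of [v k], either the exponent
    of [x_k] has grown or exactly one [z_l] has ([xexp_jump]); at the end no gap
    is left, so that setting [z_l = x_k] turns [v k] into its rank, which is the
    signature ([shift_rank]).

    For a monomial ideal, [z - x ^ d] is a zero divisor only if an associated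
    prime, which is generated by variables, contains both [z] and [x]. This is
    impossible when the exponents of [z] and [x] grow together in the generators
    ([comonotone_nzd]). Setting [z_l = x_(j l) ^ e l] for the first few [l]
    leaves a monomial ideal with the same comparability of exponents, so the
    relations [z_l - x_(j l) ^ e l] form a regular sequence in their given order,
    both for [e = d] and for [e = 1], and on the polynomial ring itself
    ([zrels_wreg]). The two isomorphisms are the substitutions
    ([zsubst_ker]).

    The height of a monomial ideal is the least number of variables that meet
    the supports of all generators, and the dimension of the quotient is the
    number of remaining variables ([height_cover], [krull_dim_cover]). The upper
    bounds on chains of primes come from algebraic independence: new elements
    picked along a chain are independent modulo its bottom, and counting
    monomials bounds their number ([indep_bound]). Least covers of [I], of its
    polarization and of its signature have the same size.

    For the depth, a regular sequence of maximal length on [R / I] leaves a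
    nonzero class that is killed by the irrelevant ideal ([ex_socle], which needs
    the finitely many maximal annihilators of a Noetherian ring and prime
    avoidance). Lifted behind the relations, it keeps this property over the
    polarization, and then no regular sequence can be longer ([depth_bound]). *)

(** * Ideals as sets and regular sequences *)

Section Ideals.
Variable A : comNzRingType.
Implicit Types (J M : set A) (x y u z : A) (s xs ys : seq A).

Definition isideal J :=
  [/\ J 0, (forall a b, J a -> J b -> J (a + b)) & (forall a b, J b -> J (a * b))].

Lemma idl0 J : isideal J -> J 0. Proof. by case. Qed.
Lemma idlD J a b : isideal J -> J a -> J b -> J (a + b).
Proof. by case=> _ h _; apply: h. Qed.
Lemma idlM J a b : isideal J -> J b -> J (a * b).
Proof. by case=> _ _ h; apply: h. Qed.
Lemma idlMr J a b : isideal J -> J a -> J (a * b).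
Proof. by rewrite mulrC; apply: idlM. Qed.
Lemma idlN J a : isideal J -> J a -> J (- a).
Proof. by move=> iJ Ja; rewrite -mulN1r; apply: idlM. Qed.
Lemma idlB J a b : isideal J -> J a -> J b -> J (a - b).
Proof. by move=> iJ Ja Jb; apply: idlD => //; apply: idlN. Qed.
Lemma idlDl J a b : isideal J -> J a -> J (a + b) -> J b.
Proof. by move=> iJ Ja Jab; rewrite -(addKr a b) addrC; apply: idlB. Qed.
Lemma idlDr J a b : isideal J -> J b -> J (a + b) -> J a.
Proof. by move=> iJ Jb; rewrite addrC; apply: idlDl. Qed.
Lemma idl_sum J (I : eqType) (r : seq I) (F : I -> A) : isideal J ->
  (forall i, i \in r -> J (F i)) -> J (\sum_(i <- r) F i).
Proof.
move=> iJ; elim: r => [|i r IH] h; first by rewrite big_nil; apply: idl0.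
rewrite big_cons; apply: idlD => //; first by apply: h; rewrite mem_head.
by apply: IH => k kr; apply: h; rewrite inE kr orbT.
Qed.

Lemma isideal_gen (X : set A) : isideal (ideal_gen X).
Proof.
split.
- by exists [::] => //; rewrite big_nil.
- move=> _ _ [s hs ->] [t ht ->]; exists (s ++ t); last by rewrite big_cat.
  by move=> c; rewrite mem_cat => /orP[/hs|/ht].
- move=> a _ [s hs ->]; exists [seq (a * c.1, c.2) | c <- s].
    by move=> _ /mapP[c cs ->] /=; apply: hs.
  by rewrite big_map mulr_sumr; apply: eq_bigr => c _; rewrite mulrA.
Qed.

Lemma sub_ideal_gen (X : set A) : X `<=` ideal_gen X.
Proof.
move=> x Xx; exists [:: (1, x)]; last by rewrite big_seq1 mul1r.
by move=> c; rewrite inE => /eqP ->.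
Qed.

Lemma ideal_gen_min (X J : set A) : isideal J -> X `<=` J -> ideal_gen X `<=` J.
Proof.
by move=> iJ XJ _ [s hs ->]; apply: idl_sum => // c cs; apply: idlM => //; exact/XJ/hs.
Qed.

Lemma isideal_idealr (I : idealr A) : isideal [set` I].
Proof.
split=> [|a b /=|a b /=]; first exact: idealr0.
- exact: rpredD.
- exact: idealMr.
Qed.

Lemma ex_idealr J : isideal J -> ~ J 1 -> {I : idealr A | [set` I] = J}.
Proof.
move=> iJ J1; pose P := fun a : A => `[< J a >].
have hP : idealr_closed P.
  split; first by apply/asboolP; apply: idl0.
    by apply/asboolP.
  move=> a u v /asboolP Ju /asboolP Jv; apply/asboolP.
  by apply: idlD => //; apply: idlM.
pose m := isIdealr.Build A P hP.
pose I : idealr A := HB.pack P m.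
by exists I; apply/seteqP; split => a /=; [move/asboolP|move=> ?; apply/asboolP].
Qed.

Definition prime_set J :=
  [/\ isideal J, ~ J 1 & forall a b, J (a * b) -> J a \/ J b].

Lemma prime_set_idealr (I : prime_idealr A) : prime_set [set` I].
Proof.
split; first exact: isideal_idealr.
  by move=> /= /idP; rewrite idealr1.
by move=> a b /=; rewrite prime_idealrM => /orP.
Qed.

Lemma ex_prime_idealr J : prime_set J -> {I : prime_idealr A | [set` I] = J}.
Proof.
move=> [iJ J1 Jp]; pose P := fun a : A => `[< J a >].
have hP : idealr_closed P.
  split; first by apply/asboolP; apply: idl0.
    by apply/asboolP.
  move=> a u v /asboolP Ju /asboolP Jv; apply/asboolP.
  by apply: idlD => //; apply: idlM.
have hQ : prime_idealr_closed P.
  move=> u v /asboolP /Jp [|] h; apply/orP; [left|right]; exact/asboolP.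
pose m := isIdealr.Build A P hP.
pose m' := isPrimeIdealrClosed.Build A P hQ.
pose I : prime_idealr A := HB.pack P m m'.
by exists I; apply/seteqP; split => a /=; [move/asboolP|move=> ?; apply/asboolP].
Qed.

Definition ext J x : set A := [set a | exists b c, J b /\ a = b + c * x].

Lemma isideal_ext J x : isideal J -> isideal (ext J x).
Proof.
move=> iJ; split.
- by exists 0, 0; split; [exact: idl0|rewrite mul0r addr0].
- move=> _ _ [b [c [Jb ->]]] [b' [c' [Jb' ->]]]; exists (b + b'), (c + c').
  by split; [exact: idlD|rewrite mulrDl addrACA].
- move=> a _ [b [c [Jb ->]]]; exists (a * b), (a * c).
  by split; [exact: idlM|rewrite mulrDr mulrA].
Qed.

Lemma sub_ext J x : J `<=` ext J x.
Proof. by move=> a Ja; exists a, 0; rewrite mul0r addr0. Qed.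

Lemma ext_gen J x : isideal J -> ext J x x.
Proof. by move=> iJ; exists 0, 1; split; [exact: idl0|rewrite mul1r add0r]. Qed.

Lemma ext_min J M x : isideal M -> J `<=` M -> M x -> ext J x `<=` M.
Proof. by move=> iM JM Mx _ [b [c [Jb ->]]]; apply: idlD; [|exact: JM|exact: idlM]. Qed.

Lemma extC J x y : isideal J -> ext (ext J x) y = ext (ext J y) x.
Proof.
move=> iJ.
suff H u v : ext (ext J u) v `<=` ext (ext J v) u by apply/seteqP; split; apply: H.
apply: ext_min; first exact/isideal_ext/isideal_ext.
  by apply: ext_min;
    [exact/isideal_ext/isideal_ext|move=> a Ja; do 2!apply: sub_ext|exact/ext_gen/isideal_ext].
by apply: sub_ext; apply: ext_gen.
Qed.

Definition extl J s := foldl ext J s.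

Lemma isideal_extl J s : isideal J -> isideal (extl J s).
Proof. by elim: s J => //= x s IH J iJ; apply/IH/isideal_ext. Qed.

Lemma sub_extl J s : J `<=` extl J s.
Proof. by elim: s J => [|x s IH] J a Ja //=; apply/IH/sub_ext. Qed.

Lemma extl_gen J s x : isideal J -> x \in s -> extl J s x.
Proof.
elim: s J => //= y s IH J iJ; rewrite inE => /orP[/eqP->|xs].
  exact/sub_extl/ext_gen.
by apply: IH => //; apply: isideal_ext.
Qed.

Lemma extl_min J M s : isideal M -> J `<=` M -> (forall x, x \in s -> M x) ->
  extl J s `<=` M.
Proof.
elim: s J => //= x s IH J iM JM sM; apply: IH => //.
  by apply: ext_min => //; apply: sM; rewrite mem_head.
by move=> y ys; apply: sM; rewrite inE ys orbT.
Qed.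

Lemma ext_extl J s x : isideal J -> ext (extl J s) x = extl (ext J x) s.
Proof.
by elim: s J => //= y s IH J iJ; rewrite extC // IH //; apply: isideal_ext.
Qed.

Lemma extl_cat J s t : extl J (s ++ t) = extl (extl J s) t.
Proof. exact: foldl_cat. Qed.

Lemma extl_rcons J s x : extl J (rcons s x) = ext (extl J s) x.
Proof. exact: foldl_rcons. Qed.

Lemma ideal_gen_extl s : ideal_gen [set` s] = extl [set 0] s.
Proof.
have i0 : isideal [set (0 : A)].
  by split=> // [a b -> ->|a b ->]; rewrite ?addr0 ?mulr0.
apply/seteqP; split.
  apply: ideal_gen_min; first exact: isideal_extl.
  by move=> x /= xs; apply: extl_gen.
apply: extl_min; first exact: isideal_gen.
  by move=> _ ->; apply: idl0; apply: isideal_gen.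
by move=> x xs; apply: sub_ideal_gen.
Qed.

Definition nzd J x := forall a, J (x * a) -> J a.

(** The regularity condition alone: the quotient by the whole sequence may vanish. *)
Fixpoint wreg J s :=
  if s is x :: s' then nzd J x /\ wreg (ext J x) s' else True.

Lemma wregP J s : wreg J s <->
  forall i, (i < size s)%N -> nzd (extl J (take i s)) s`_i.
Proof.
elim: s J => [|x s IH] J //=; split.
  by move=> [h /IH k] [|i] //= lis; apply: k.
move=> h; split; first exact: (h 0%N).
by apply/IH => i lis; apply: (h i.+1).
Qed.

Lemma wreg_cat J s t : wreg J (s ++ t) <-> wreg J s /\ wreg (extl J s) t.
Proof.
elim: s J => [|x s IH] J /=; first by split => // -[].
by rewrite IH; split=> [[? []]|[[]]].
Qed.

(** A list, so that a single element can be chosen regular modulo all the partial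
    sums at once. *)
Fixpoint prefixes J s := J :: if s is x :: s' then prefixes (ext J x) s' else [::].

End Ideals.

(** * Zero divisors and depth in Noetherian rings *)

Section Noetherian.
Variable A : comNzRingType.
Implicit Types (J M P : set A) (x y u z : A) (s xs ys : seq A).

Definition noetherian := forall F : nat -> set A,
  (forall i, isideal (F i)) -> (forall i, F i `<=` F i.+1) ->
  exists i, F i.+1 `<=` F i.

Hypothesis noethA : noetherian.

(** Otherwise dependent choice builds a strictly increasing chain above [J]. *)
Lemma noetherian_max (S : set (set A)) J : (forall M, S M -> isideal M) -> S J ->
  exists2 M, S M /\ J `<=` M & forall N, S N -> M `<=` N -> N `<=` M.
Proof.
move=> Sid SJ; apply: contrapT => noM.
pose T := {M : set A | S M /\ J `<=` M}.
have step (m : T) : exists m' : T, sval m `<=` sval m' /\ ~ (sval m' `<=` sval m).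
  apply: contrapT => no; apply: noM; exists (sval m); first exact: (svalP m).
  move=> N SN mN; apply: contrapT => Nm; apply: no.
  have hN : S N /\ J `<=` N by split=> // a Ja; apply/mN/(svalP m).2.
  by exists (exist _ N hN).
have [f fP] := choice step.
have hJ : S J /\ J `<=` J by split.
pose F i := sval (iter i f (exist _ J hJ : T)).
have [||i] := @noethA F.
- by move=> i; apply: Sid; apply: (svalP (iter i f _)).1.
- by move=> i; have [] := fP (iter i f (exist _ J hJ)).
- by have [] := fP (iter i f (exist _ J hJ)).
Qed.

Definition colon J u : set A := [set a | J (a * u)].

Lemma isideal_colon J u : isideal J -> isideal (colon J u).
Proof.
move=> iJ; split; rewrite /colon /=.
- by rewrite mul0r; apply: idl0.
- by move=> a b; rewrite mulrDl; apply: idlD.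
- by move=> a b; rewrite -mulrA; apply: idlM.
Qed.

Definition max_colon J u :=
  ~ J u /\ forall w, ~ J w -> colon J u `<=` colon J w -> colon J w `<=` colon J u.

(** Maximality is taken among the colon ideals that contain [colon J b]. *)
Lemma max_colon_above J b : isideal J -> ~ J b ->
  exists2 u, max_colon J u & colon J b `<=` colon J u.
Proof.
move=> iJ Jb.
have [||M [[u Ju ->] bu] hM] :=
  @noetherian_max [set M | exists2 w, ~ J w & M = colon J w] (colon J b).
- by move=> _ [w _ ->]; apply: isideal_colon.
- by exists b.
exists u => //; split => // w Jw; apply: hM; by exists w.
Qed.

(** If [y * u] is not in [J], its colon ideal contains that of [u], hence equals it
    by maximality. *)
Lemma max_colon_prime J u : isideal J -> max_colon J u -> prime_set (colon J u).
Proof.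
move=> iJ [Ju hu]; split; first exact: isideal_colon.
  by rewrite /colon /= mul1r.
move=> x y xy; have [yu|yu] := pselect (J (y * u)); [by right|left].
apply: (hu _ yu); last by rewrite /colon /= mulrA.
by move=> a au; rewrite /colon /= mulrCA; apply: idlM.
Qed.

Lemma colon_mul_extl J us w y : isideal J ->
  (forall u, u \in us -> J (y * u)) -> extl J us w -> J (y * w).
Proof.
move=> iJ hy; have : extl J us `<=` colon J y.
  apply: extl_min; first exact: isideal_colon.
    by move=> a Ja; rewrite /colon /=; apply: idlMr.
  by move=> u uus; rewrite /colon /= mulrC; apply: hy.
by move=> h /h; rewrite /colon /= mulrC.
Qed.

(** Take [us] such that [extl J us] is maximal. If the prime [colon J w] contained
    none of the [colon J u], a product of elements of the latter outside [colon J w]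
    would kill [us] modulo [J], hence also [w], which lies in [extl J us]. *)
Lemma zero_divisor_primes J : isideal J ->
  exists us : seq A, (forall u, u \in us -> max_colon J u) /\
    forall a b, J (a * b) -> ~ J b -> exists2 u, u \in us & colon J u a.
Proof.
move=> iJ.
pose S := [set M | exists2 us : seq A, (forall u, u \in us -> max_colon J u) & M = extl J us].
have [||_ [[us hus ->] _] hM] := @noetherian_max S J.
- by move=> _ [us _ ->]; apply: isideal_extl.
- by exists [::].
exists us; split => // a b Jab Jb.
have [w mw bw] := max_colon_above iJ Jb.
have [w1 | ] := pselect (exists2 u, u \in us & colon J u `<=` colon J w).
  case: w1 => u uus uw; exists u => //; exact: ((hus _ uus).2 w mw.1 uw a (bw _ Jab)).
move=> no; exfalso.
have [iw nw pw] := max_colon_prime iJ mw.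
have wus : extl J us w.
  apply: (hM (extl J (rcons us w))).
  - exists (rcons us w) => // u; rewrite mem_rcons inE => /orP[/eqP->//|]; exact: hus.
  - by rewrite extl_rcons; apply: sub_ext.
  - by rewrite extl_rcons; apply/ext_gen/isideal_extl.
have [y [yus yw]] : exists y, (forall u, u \in us -> J (y * u)) /\ ~ colon J w y.
  have : forall u, u \in us -> ~ (colon J u `<=` colon J w).
    by move=> u uus uw; apply: no; exists u.
  elim: (us) => [_|u vs IH h]; first by exists 1; split.
  have [|y [hy yw]] := IH; first by move=> v vvs; apply: h; rewrite inE vvs orbT.
  have /existsNP[x /not_implyP[xu xw]] := h u (mem_head _ _).
  exists (x * y); split; last by case/pw.
  move=> v; rewrite inE => /orP[/eqP->|/hy yv]; last by rewrite -mulrA; apply: idlM.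
  by rewrite mulrAC; apply: idlMr.
exact/yw/(colon_mul_extl iJ yus).
Qed.

(** After dropping the members that lie in another one, an element that avoids all
    members but one can be corrected by a product taken in the others. *)
Lemma prime_avoidance M (Ps : seq (set A)) : isideal M ->
  (forall i, (i < size Ps)%N -> prime_set (nth setT Ps i)) ->
  (forall i, (i < size Ps)%N -> exists2 a, M a & ~ nth setT Ps i a) ->
  exists2 a, M a & forall i, (i < size Ps)%N -> ~ nth setT Ps i a.
Proof.
move=> iM; have [k] := ubnP (size Ps); elim: k Ps => // k IH [|P Ps] /=.
  by exists 0 => //; apply: idl0.
move=> szP pP nP.
have pPs i : (i < size Ps)%N -> prime_set (nth setT Ps i) by move=> h; apply: (pP i.+1).
have nPs i : (i < size Ps)%N -> exists2 a, M a & ~ nth setT Ps i a.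
  by move=> h; apply: (nP i.+1).
have [[j [jP jsub]]|no] := pselect (exists j, (j < size Ps)%N /\ nth setT Ps j `<=` P).
  (* an ideal that lies in another one can be dropped *)
  pose Qs := P :: (take j Ps ++ drop j.+1 Ps).
  have szQ : size Qs = size Ps.
    rewrite /= size_cat size_take size_drop jP; move: jP; clear.
    by move=> h; rewrite -addSn subnKC.
  have nthQ i : (i < size Qs)%N -> exists2 i', (i' < (size Ps).+1)%N &
      nth setT Qs i = nth setT (P :: Ps) i'.
    case: i => [|i] /=; first by exists 0%N.
    rewrite size_cat size_take size_drop jP ltnS => hi.
    have szj : size (take j Ps) = j by rewrite size_take jP.
    rewrite nth_cat szj; case: ifP => ij.
      by exists i.+1; [rewrite ltnS (ltn_trans ij)|rewrite /= nth_take].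
    rewrite nth_drop; exists (j.+1 + (i - j)).+1 => //=.
    rewrite ltnS addSn subnKC; last by rewrite leqNgt ij.
    move: hi; rewrite -ltnS -addSn subnKC //.
  have [| | |a Ma ha] := IH Qs.
  - by rewrite szQ.
  - by move=> i /nthQ[i' hi' ->]; apply: pP.
  - by move=> i /nthQ[i' hi' ->]; apply: nP.
  exists a => // -[_|i] /=; first exact: (ha 0%N).
  rewrite ltnS => hi.
  have [ij|ji|->] := ltngtP i j.
  - have := ha i.+1; rewrite szQ /= nth_cat size_take jP ij nth_take //.
    by apply; apply: leq_ltn_trans ij jP.
  - have := ha i; case: i hi ji => // i hi ji.
    have ijF : (i < j)%N = false by rewrite ltnNge -ltnS ji.
    rewrite szQ /= nth_cat size_take jP ijF nth_drop addSn subnKC //.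
    by apply.
  - by move=> /jsub; apply: (ha 0%N).
have [//|//|//|a Ma ha] := IH Ps.
have [Pa|nPa] := pselect (P a); last first.
  by exists a => // -[|i] //= hi; apply: ha.
have [iP P1 pm] := pP 0%N isT.
have [x Mx Px] := nP 0%N isT.
have [y yPs Py] : exists2 y, (forall i, (i < size Ps)%N -> nth setT Ps i y) & ~ P y.
  have : forall j, (j < size Ps)%N -> ~ (nth setT Ps j `<=` P).
    by move=> j jP jsub; apply: no; exists j.
  elim: (Ps) pPs => [|Q Qs IHQ] pPs h; first by exists 1.
  have [||y hy Py] := IHQ.
  - by move=> i hi; apply: (pPs i.+1).
  - by move=> j hj; apply: (h j.+1).
  have /existsNP[w /not_implyP[Qw Pw]] := h 0%N isT.
  exists (w * y); last by case/pm.
  case=> [_|i hi] /=; first by apply: idlMr => //; case: (pPs 0%N isT).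
  apply: idlM; last exact: hy.
  by case: (pPs i.+1 hi).
exists (a + x * y); first by apply: idlD => //; apply: idlMr.
case=> [_|i hi] /=.
  by move=> h; have /pm[] : P (x * y) by apply: idlDl h.
move=> h; apply: (ha i hi); apply: idlDr h; first by case: (pPs i hi).
by apply: idlM; [case: (pPs i hi)|apply: yPs].
Qed.

(** Such a class prevents every element of [M] from being regular modulo [J]. *)
Definition socle_at M J u := ~ J u /\ forall a, M a -> J (a * u).

(** The zero-divisor primes of all the ideals are avoided simultaneously. *)
Lemma common_nzd M (Js : seq (set A)) : isideal M ->
  (forall i, (i < size Js)%N -> isideal (nth setT Js i)) ->
  (forall i, (i < size Js)%N -> ~ exists u, socle_at M (nth setT Js i) u) ->
  exists2 a, M a & forall i, (i < size Js)%N -> nzd (nth setT Js i) a.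
Proof.
move=> iM iJs nsoc.
have [Ps [pPs nPs hPs]] : exists Ps : seq (set A),
  [/\ forall i, (i < size Ps)%N -> prime_set (nth setT Ps i),
      forall i, (i < size Ps)%N -> exists2 a, M a & ~ nth setT Ps i a
    & forall i a, (i < size Js)%N -> ~ nzd (nth setT Js i) a ->
        exists2 k, (k < size Ps)%N & nth setT Ps k a].
  elim: Js iJs nsoc => [|J Js IH] iJs nsoc; first by exists [::].
  have [||Ps [p1 p2 p3]] := IH.
  - by move=> i hi; apply: (iJs i.+1).
  - by move=> i hi; apply: (nsoc i.+1).
  have iJ := iJs 0%N isT; rewrite /= in iJ.
  have [us [hus hab]] := zero_divisor_primes iJ.
  exists ([seq colon J u | u <- us] ++ Ps); split.
  - move=> i; rewrite size_cat size_map nth_cat size_map; case: (ltnP i (size us)) => hi.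
      move=> _; rewrite (nth_map 0) //.
      exact: (max_colon_prime iJ (hus _ (mem_nth 0 hi))).

    by move=> h; apply: p1; rewrite ltn_subLR.
  - move=> i; rewrite size_cat size_map nth_cat size_map; case: (ltnP i (size us)) => hi.
      move=> _; rewrite (nth_map 0) //; set u := us`_i.
      apply: contrapT => no; apply: (nsoc 0%N isT); exists u; split => /=.
        by have [] := hus u (mem_nth 0 hi).
      by move=> a Ma; apply: contrapT => h; apply: no; exists a.
    by move=> h; apply: p2; rewrite ltn_subLR.
  - case=> [|i] a /=; last first.
      move=> /p3 h /h [k hk ka]; exists (size us + k)%N.
        by rewrite size_cat size_map ltn_add2l.
      by rewrite nth_cat size_map ltnNge leq_addr /= addKn.
    move=> _ /existsNP[b /not_implyP[Jab Jb]].
    have [u uus ua] := hab _ _ Jab Jb.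
    exists (index u us).
      by rewrite size_cat size_map ltn_addr // index_mem.
    by rewrite nth_cat size_map index_mem uus (nth_map 0) ?index_mem // nth_index.
have [a Ma ha] := prime_avoidance iM pPs nPs.
exists a => // i hi; apply: contrapT => /(hPs _ _ hi)[k hk]; exact: ha.
Qed.

(** An element that is regular modulo all partial sums can be moved to the front. *)
Lemma wreg_ext_nzd J xs z : isideal J -> wreg J xs ->
  (forall i, (i <= size xs)%N -> nzd (nth setT (prefixes J xs) i) z) ->
  wreg (ext J z) xs.
Proof.
elim: xs J => //= x xs IH J iJ [xJ xsJ] hz; split.
  have zJx : nzd (ext J x) z by have := hz 1%N; case: (xs) => [|? ?] /= h; exact: h.
  move=> a [b [c [Jb e]]].
  have : ext J x c.
    apply: zJx; exists (- b), a; split; first exact: idlN.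
    by rewrite addrC -[z * c]mulrC -[a * x]mulrC e addrC addKr.
  move=> [b' [c' [Jb' ec]]].
  exists (a - c' * z), c'; split; last by rewrite addrNK.
  apply: xJ; rewrite mulrBr e ec mulrDl.
  have -> : b + (b' * z + c' * x * z) - x * (c' * z) = b + b' * z.
    by rewrite [c' * x]mulrC -!mulrA addrA addrK.
  by apply: idlD => //; apply: idlMr.
rewrite extC //; apply: IH => //; first exact: isideal_ext.
by move=> i hi; apply: (hz i.+1).
Qed.

(** Modulo [J], [z * u] is a multiple [v * x] of [x], and [v] is the new class. *)
Lemma socle_exchange M J x z u : isideal J -> M z -> nzd J x -> nzd J z ->
  socle_at M (ext J x) u -> exists v, socle_at M (ext J z) v.
Proof.
move=> iJ Mz xJ zJ [Ju Mu].
have [b [v [Jb zu]]] := Mu z Mz.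
exists v; split.
  move=> [b' [w [Jb' ev]]]; apply: Ju.
  suff h : J (u - w * x).
    by exists (u - w * x), w; split => //; rewrite addrNK.
  apply: zJ; rewrite mulrBr zu ev mulrDl.
  have -> : b + (b' * x + w * z * x) - z * (w * x) = b + b' * x.
    by rewrite [w * z]mulrC -!mulrA addrA addrK.
  by apply: idlD => //; apply: idlMr.
move=> a Ma; have [b' [c [Jb' e]]] := Mu a Ma.
suff h : J (a * v - c * z).
  by exists (a * v - c * z), c; split => //; rewrite addrNK.
apply: xJ.
have -> : x * (a * v - c * z) = a * (z * u) - a * b - z * (a * u) + z * b'.
  by rewrite zu e; ring.
have -> : a * (z * u) - a * b - z * (a * u) + z * b' = z * b' - a * b.
  by ring.
by apply: idlB => //; apply: idlM.
Qed.

Lemma wreg_nosocle M J s x : isideal J -> (forall y, y \in rcons s x -> M y) ->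
  wreg J (rcons s x) ->
  forall i, (i <= size s)%N -> ~ exists w, socle_at M (nth setT (prefixes J s) i) w.
Proof.
elim: s J => [|y s IH] J iJ Ms /=.
  by move=> [xJ _] [|i] //= _ [w [Jw /(_ x (Ms _ (mem_head _ _))) /xJ]].
move=> [yJ sJ] [|i] /= hi.
  by case=> w [Jw /(_ y (Ms _ (mem_head _ _))) /yJ].
apply: IH => //; first exact: isideal_ext.
by move=> z zs; apply: Ms; rewrite inE zs orbT.
Qed.

Lemma size_prefixes J s : size (prefixes J s) = (size s).+1.
Proof. by elim: s J => //= x s IH J; rewrite IH. Qed.

Lemma prefixes_ideal J s i : isideal J -> (i <= size s)%N ->
  isideal (nth setT (prefixes J s) i).
Proof.
elim: s J i => [|x s IH] J [|i] //= iJ hi.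
by apply: IH => //; apply: isideal_ext.
Qed.

Lemma nth_prefixes J s : nth setT (prefixes J s) (size s) = extl J s.
Proof. by elim: s J => //= x s IH J; rewrite IH. Qed.

(** Some [z] in [M] is regular modulo all the proper partial sums of both
    sequences. It can replace the last element of each, keeping the killed class by
    [socle_exchange], and then move to the front: both sequences lose one element
    when [J] is replaced by [ext J z]. *)
Theorem depth_bound M J xs ys u : isideal M -> isideal J ->
  (forall x, x \in xs -> M x) -> wreg J xs -> socle_at M (extl J xs) u ->
  (forall y, y \in ys -> M y) -> wreg J ys -> (size ys <= size xs)%N.
Proof.
move=> iM; have [k] := ubnP (size xs).
elim: k J xs ys u => // k IH J xs ys u szx iJ Mxs rxs soc Mys rys.
case: (ltnP (size xs) (size ys)) => // sz.
case: (lastP xs) szx Mxs rxs soc sz => [|xs' x] szx Mxs rxs soc sz.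
  case: ys Mys rys sz => // y ys Mys [yJ _] _.
  by have [Ju /(_ y (Mys _ (mem_head _ _)))/yJ] := soc.
case: (lastP ys) Mys rys sz => // ys' y Mys rys.
rewrite !size_rcons ltnS => sz.
have iMx (s : seq A) w : (forall v, v \in rcons s w -> M v) -> forall v, v \in s -> M v.
  by move=> h v vs; apply: h; rewrite mem_rcons inE vs orbT.
have [||z Mz hz] := @common_nzd M (prefixes J xs' ++ prefixes J ys') iM.
- move=> i; rewrite size_cat !size_prefixes nth_cat size_prefixes => hi.
  case: ltnP => h; apply: prefixes_ideal => //.
  by rewrite -ltnS ltn_subLR.
- move=> i; rewrite size_cat !size_prefixes nth_cat size_prefixes => hi.
  case: ltnP => h; first exact: wreg_nosocle rxs _ h.
  by apply: wreg_nosocle rys _ _ => //; rewrite -ltnS ltn_subLR.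
have zxs i : (i <= size xs')%N -> nzd (nth setT (prefixes J xs') i) z.
  move=> hi; have := hz i; rewrite size_cat !size_prefixes nth_cat size_prefixes.
  by rewrite ltnS hi; apply; rewrite ltn_addr.
have zys i : (i <= size ys')%N -> nzd (nth setT (prefixes J ys') i) z.
  move=> hi; have := hz ((size xs').+1 + i)%N.
  rewrite size_cat !size_prefixes nth_cat size_prefixes.
  by rewrite ltn_add2l [X in if X then _ else _]ltnNge leq_addr addKn; apply.
move: (rxs) (rys); rewrite -!cats1 => /wreg_cat[rxs' [xJ _]] /wreg_cat[rys' _].
have zJ : nzd (extl J xs') z by rewrite -nth_prefixes; apply: zxs.
have iJx : isideal (extl J xs') by apply: isideal_extl.
move: soc; rewrite extl_rcons => /(socle_exchange iJx Mz xJ zJ)[v].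
rewrite ext_extl // => soc.
suff : (size ys' <= size xs')%N by rewrite leqNgt sz.
apply: (IH (ext J z) xs' ys' v) => //.
- by rewrite -ltnS -(size_rcons xs' x).
- exact: isideal_ext.
- exact: iMx Mxs.
- exact: wreg_ext_nzd.
- exact: iMx Mys.
- exact: wreg_ext_nzd.
Qed.

(** If all elements of [M] are zero divisors, then by avoidance [M] lies in one of
    the zero-divisor primes. *)
Lemma ex_socle M J : isideal M -> isideal J -> (forall a, M a -> ~ nzd J a) ->
  exists u, socle_at M J u.
Proof.
move=> iM iJ h; apply: contrapT => no.
have [||a Ma ha] := @common_nzd M [:: J] iM; try by case.
exact: (h a Ma (ha 0%N isT)).
Qed.
End Noetherian.

(** * Polynomial rings: finiteness and algebraic independence *)

(** Choose repeatedly a position where the remaining tail is minimal. *)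
Lemma nat_mono_subseq (h : nat -> nat) : exists g : nat -> nat,
  (forall i j, (i < j)%N -> (g i < g j)%N) /\
  (forall i j, (i < j)%N -> (h (g i) <= h (g j))%N).
Proof.
have mn m : exists i, (m <= i)%N /\ forall j, (m <= j)%N -> (h i <= h j)%N.
  have ex : exists v, `[< exists2 i, (m <= i)%N & h i = v >].
    by exists (h m); apply/asboolP; exists m.
  case: (ex_minnP ex) => v /asboolP[i mi <-] hv; exists i; split => // j mj.
  by apply: hv; apply/asboolP; exists j.
have [mi hmi] := choice mn.
pose g := fix g i := if i is i'.+1 then mi (g i').+1 else mi 0%N.
have gS i : (g i < g i.+1)%N by have [] := hmi (g i).+1.
have gm i j : (i < j)%N -> (g i < g j)%N.
  elim: j => // j IH; rewrite ltnS leq_eqVlt => /orP[/eqP->//|/IH h'].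
  exact: ltn_trans (gS j).
exists g; split => // i j ij.
case: i ij => [|i] ij; first by apply: (hmi 0%N).2.
by apply: (hmi (g i).+1).2; apply: gm; apply: ltn_trans ij.
Qed.

(** Monotone subsequences are extracted for one coordinate after the other. *)
Lemma dickson n (f : nat -> 'X_{1..n}) : exists i j, (i < j)%N /\ (f i <= f j)%MM.
Proof.
suff [g [gm hg]] : exists g : nat -> nat, (forall i j, (i < j)%N -> (g i < g j)%N) /\
    forall k, k \in enum 'I_n -> forall i j, (i < j)%N -> (f (g i) k <= f (g j) k)%N.
  exists (g 0%N), (g 1%N); split; first exact: gm.
  by apply/mnm_lepP => k; apply: hg; rewrite ?mem_enum.
elim: (enum 'I_n) => [|k s [g [gm hg]]]; first by exists id.
have [g' [gm' hg']] := nat_mono_subseq (fun i => f (g i) k).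
exists (g \o g'); split => [i j ij|l]; first by apply/gm/gm'.
rewrite inE => /orP[/eqP->|ls] i j ij; first exact: hg'.
by apply: hg => //; apply: gm'.
Qed.

Section MPoly.
Variables (K : fieldType) (n : nat).
Local Notation S := {mpoly K[n]}.
Implicit Types (p q : S) (J : set S) (m : 'X_{1..n}) (C D : {set 'I_n}).

Lemma ex_min_mlead (P : set S) p : P p ->
  exists2 q, P q & forall q', P q' -> (mlead q <= mlead q')%O.
Proof.
elim/(well_founded_induction (@ltom_wf n)): {p}(mlead p) {-2}p (erefl (mlead p)) => m IH p mp Pp.
have [[q Pq lt]|no] := pselect (exists2 q, P q & (mlead q < mlead p)%O).
  by apply: (IH (mlead q)) Pq => //; rewrite -mp.
exists p => // q Pq; rewrite Order.TotalTheory.leNgt; apply/negP => lt.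
by apply: no; exists q.
Qed.

(** In a strictly increasing chain choose new elements of least leading monomial. By
    Dickson's lemma one of these monomials divides a later one, and cancelling the
    later leading term yields a new element with a smaller leading monomial. *)
Lemma noetherian_mpoly : noetherian S.
Proof.
move=> F iF sF; apply: contrapT => no.
have stp i : exists q, (F i.+1 q /\ ~ F i q) /\
    forall q', F i.+1 q' /\ ~ F i q' -> (mlead q <= mlead q')%O.
  have /existsNP[p /not_implyP hp] : ~ (F i.+1 `<=` F i) by move=> h; apply: no; exists i.
  by have [q] := @ex_min_mlead [set q | F i.+1 q /\ ~ F i q] p hp; exists q.
have [f hf] := choice stp.
have Fmono i j : (i <= j)%N -> F i `<=` F j.
  elim: j => [|j IH]; first by rewrite leqn0 => /eqP->.
  rewrite leq_eqVlt => /orP[/eqP->//|]; rewrite ltnS => /IH h a /h; exact: sF.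
have [i [j [ij le]]] := dickson (fun i => mlead (f i)).
have [[fi1 fi0] _] := hf i; have [[fj1 fj0] hj] := hf j.
have fi_n0 : f i != 0.
  by apply/eqP => e; apply: fi0; rewrite e; apply: idl0.
pose c := mleadc (f j) / mleadc (f i).
pose m := (mlead (f j) - mlead (f i))%MM.
pose q := f j - c *: (f i * 'X_[m]).
have em : (m + mlead (f i))%MM = mlead (f j) by rewrite submK.
have Fq : F j (c *: (f i * 'X_[m])).
  rewrite -mul_mpolyC; apply: idlM => //; apply: idlMr => //.
  by apply: (Fmono i.+1).
have qj1 : F j.+1 q by apply: idlB => //; apply: sF.
have qj0 : ~ F j q.
  by move=> h; apply: fj0; rewrite -(subrK (c *: (f i * 'X_[m])) (f j)); apply: idlD.
have q_n0 : q != 0 by apply/eqP => e; apply: qj0; rewrite e; apply: idl0.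
have lq := hj q (conj qj1 qj0).
have : (mlead q <= mlead (f j))%O.
  apply: Order.POrderTheory.le_trans (mleadB_le _ _) _.
  rewrite Order.TotalTheory.ge_max Order.POrderTheory.lexx /=.
  apply: Order.POrderTheory.le_trans (mleadZ_le _ _) _.
  apply: Order.POrderTheory.le_trans (mleadM_le _ _) _.
  by rewrite mleadXm addmC em.
move=> lq'; have e : mlead q = mlead (f j).
  by apply: Order.POrderTheory.le_anti; rewrite lq lq'.
have : mleadc q == 0.
  rewrite e /q mcoeffB mcoeffZ -em mcoeffMX /c em -mulrA mulVf ?mulr1 ?subrr //.
  by rewrite mleadc_eq0.
by rewrite mleadc_eq0 (negbTE q_n0).
Qed.

Definition off C m := [forall i in C, m i == 0%N].

Lemma offP C m : reflect (forall i, i \in C -> m i = 0%N) (off C m).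
Proof.
by apply: (iffP forall_inP) => h i iC; apply/eqP; [exact: h|rewrite h].
Qed.

Lemma offPn C m : reflect (exists2 i, i \in C & m i != 0%N) (~~ off C m).
Proof.
rewrite negb_forall_in; apply: exists_inP.
Qed.

(** The prime ideal generated by the variables in [C], given by vanishing
    coefficients so that linear algebra decides membership. *)
Definition var_set C : set S := [set p | forall m, off C m -> p@_m = 0].

Definition var_kill C p : S := p \mPo [tuple if i \in C then 0 else 'X_i | i < n].

Lemma var_killX C m : var_kill C 'X_[m] = if off C m then 'X_[m] else 0.
Proof.
rewrite /var_kill comp_mpolyX; case: ifPn => [/offP h|/offPn[i iC mi]].
  rewrite mpolyXE_id; apply: eq_bigr => i _; rewrite tnth_mktuple.
  by case: ifP => // /h ->.
by rewrite (bigD1 i) //= tnth_mktuple iC expr0n (negbTE mi) mul0r.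
Qed.

Lemma var_kill_coeff C p m : (var_kill C p)@_m = if off C m then p@_m else 0.
Proof.
have -> : var_kill C p = \sum_(k <- msupp p) p@_k *: var_kill C 'X_[k].
  rewrite {1}/var_kill {1}[p]mpolyE raddf_sum /=.
  by apply: eq_bigr => k _; rewrite comp_mpolyZ.
rewrite raddf_sum /=; under eq_bigr => k _ do rewrite mcoeffZ var_killX.
rewrite {3}[p]mpolyE raddf_sum /=.
case: ifP => om.
  apply: eq_bigr => k _; rewrite mcoeffZ; case: ifP => // ok.
  rewrite mcoeff0 mcoeffX; case: eqP => [e|//].
  by rewrite -e ok in om.
apply: big1 => k _; case: ifP => ok; last by rewrite mcoeff0 mulr0.
by rewrite mcoeffX; case: eqP => [e|]; [rewrite e om in ok|rewrite mulr0].
Qed.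

Lemma var_setE C p : var_set C p <-> var_kill C p = 0.
Proof.
split=> [h|h m om].
  by apply/mpolyP => m; rewrite var_kill_coeff mcoeff0; case: ifP => // /h.
by have := var_kill_coeff C p m; rewrite h mcoeff0 om.
Qed.

Lemma var_set_prime C : prime_set (var_set C).
Proof.
split.
- split; first by move=> m _; rewrite mcoeff0.
    by move=> a b ha hb m om; rewrite mcoeffD ha // hb // addr0.
  by move=> a b; rewrite !var_setE /var_kill rmorphM /= => ->; rewrite mulr0.
- by rewrite var_setE /var_kill rmorph1 => /eqP; rewrite oner_eq0.
- move=> a b; rewrite !var_setE /var_kill rmorphM /= => /eqP.
  by rewrite mulf_eq0 => /orP[] /eqP; [left|right].
Qed.

Lemma var_setX C i : var_set C 'X_i <-> i \in C.
Proof.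
split=> [h|iC m /offP/(_ _ iC) mi].
  apply/negPn/negP => iC; have /eqP : ('X_i : S)@_U_(i) = 0.
    apply: h; apply/offP => j jC; rewrite mnm1E; case: eqP => // e.
    by rewrite e jC in iC.
  by rewrite mcoeffX eqxx oner_eq0.
rewrite mcoeffX; case: eqP => // e; move: mi; rewrite -e mnm1E eqxx //.
Qed.

Lemma monomial_in_ideal J m i : isideal J -> J 'X_i -> m i != 0%N -> J 'X_[m].
Proof.
move=> iJ Ji mi; rewrite -(@submK _ U_(i) m) ?lep1mP // mpolyXD.
exact: idlM.
Qed.

Lemma var_set_min C J : isideal J -> (forall i, i \in C -> J 'X_i) -> var_set C `<=` J.
Proof.
move=> iJ h p hp; rewrite [p]mpolyE; apply: idl_sum => // m mp.
rewrite -mul_mpolyC; apply: idlM => //.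
case: (boolP (off C m)) => [om|/offPn[i iC mi]]; last exact: monomial_in_ideal (h i iC) mi.
by move: mp; rewrite mcoeff_msupp hp ?eqxx.
Qed.

Lemma var_set_sub C D : C \subset D -> var_set C `<=` var_set D.
Proof.
move=> /fintype.subsetP CD; apply: var_set_min; first by have [] := var_set_prime D.
by move=> i /CD iD; apply/var_setX.
Qed.

Fixpoint lincomb (c : nat -> K) (l : seq S) : S :=
  if l is x :: l' then c 0%N *: x + lincomb (fun i => c i.+1) l' else 0.

Definition lin_indep J l := forall c, J (lincomb c l) ->
  forall i, (i < size l)%N -> c i = 0.

Lemma lincomb_cat c l l' :
  lincomb c (l ++ l') = lincomb c l + lincomb (fun i => c (size l + i)%N) l'.
Proof. by elim: l c => [|x l IH] c /=; rewrite ?add0r // IH addrA. Qed.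

Lemma lincomb_map c f l : lincomb c [seq f * x | x <- l] = f * lincomb c l.
Proof. by elim: l c => [|x l IH] c /=; rewrite ?mulr0 // IH mulrDr scalerAr. Qed.

Lemma lincomb0 c l : (forall i, (i < size l)%N -> c i = 0) -> lincomb c l = 0.
Proof.
elim: l c => //= x l IH c h; rewrite (h 0%N) // scale0r add0r IH //.
by move=> i hi; apply: (h i.+1).
Qed.

Lemma lincombE c l : lincomb c l = \sum_(i < size l) c i *: l`_i.
Proof. by elim: l c => [|x l IH] c /=; rewrite ?big_ord0 // big_ord_recl IH. Qed.

Fixpoint powers B f (l : seq S) :=
  if B is B'.+1 then l ++ [seq f * x | x <- powers B' f l] else [::].

Fixpoint monoms B (s : seq S) :=
  if s is f :: s' then powers B f (monoms B s') else [:: 1].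

Lemma size_powers B f l : size (powers B f l) = (B * size l)%N.
Proof. by elim: B => //= B IH; rewrite size_cat size_map IH mulSn. Qed.

Lemma size_monoms B s : size (monoms B s) = (B ^ size s)%N.
Proof. by elim: s => //= f s IH; rewrite size_powers IH expnS. Qed.

(** A combination of [powers] is [a + f * b] with [a] a combination of [l]: modulo
    [ext J f] only [a] survives, and then [f] cancels. *)
Lemma powers_indep J f B l : isideal J -> nzd J f -> lin_indep (ext J f) l ->
  lin_indep J (powers B f l).
Proof.
move=> iJ fJ hl; elim: B => [|B IH] c //=.
rewrite lincomb_cat lincomb_map size_cat size_map => h.
have z1 : forall i, (i < size l)%N -> c i = 0.
  apply: hl; set a := lincomb c l in h *; set b := lincomb _ _ in h.
  exists (a + f * b), (- b); split => //.
  by rewrite mulNr [b * f]mulrC addrK.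
move: h; rewrite lincomb0 // add0r => /fJ /IH z2 i hi.
case: (ltnP i (size l)) => [|li]; first exact: z1.
by rewrite -(subnKC li); apply: z2; rewrite ltn_subLR.
Qed.

(** Regular sequences and strictly increasing chains of primes both give such
    sequences. *)
Fixpoint nz_chain J (s : seq S) :=
  if s is f :: s' then
    nzd J f /\ exists J', [/\ isideal J', ext J f `<=` J' & nz_chain J' s']
  else ~ J 1.

Lemma monoms_indep J s B : isideal J -> nz_chain J s -> lin_indep J (monoms B s).
Proof.
elim: s J => [|f s IH] J iJ /=.
  move=> J1 c /=; rewrite addr0 => h [|] // _; apply/eqP/negPn/negP => c0.
  by apply: J1; rewrite -(scale1r 1) -(mulVf c0) -scalerA -mul_mpolyC; apply: idlM.
move=> [fJ [J' [iJ' sub hs]]]; apply: powers_indep => // c h.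
by apply: (IH J') => //; apply: sub.
Qed.

Lemma wreg_nz_chain J s : isideal J -> wreg J s -> ~ extl J s 1 -> nz_chain J s.
Proof.
elim: s J => //= f s IH J iJ [fJ sJ] s1; split => //.
by exists (ext J f); split => //; [exact: isideal_ext|apply: IH => //; exact: isideal_ext].
Qed.

Lemma msizeM_leS (p q : S) a b : (msize p <= a.+1)%N -> (msize q <= b.+1)%N ->
  (msize (p * q) <= (a + b).+1)%N.
Proof.
move=> hp hq.
have [->|p0] := eqVneq p 0; first by rewrite mul0r mmeasure0.
have [->|q0] := eqVneq q 0; first by rewrite mulr0 mmeasure0.
rewrite msizeM_proper; last by rewrite mulf_neq0 // mleadc_eq0.
by rewrite -subn1 leq_subLR add1n -addnS -addSn; apply: leq_add.
Qed.

Lemma msize_powers B f l E t : (msize f <= E.+1)%N ->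
  (forall x, x \in l -> msize x <= t.+1)%N ->
  forall x, x \in powers B f l -> (msize x <= (B * E + t).+1)%N.
Proof.
move=> hf hl; elim: B => //= B IH x; rewrite mem_cat => /orP[/hl h|/mapP[y /IH hy ->]].
  by apply: leq_trans h _; rewrite ltnS leq_addl.
by rewrite mulSn -addnA; apply: msizeM_leS.
Qed.

Lemma msize_monoms B s E : (forall x, x \in s -> msize x <= E.+1)%N ->
  forall x, x \in monoms B s -> (msize x <= (B * E * size s).+1)%N.
Proof.
elim: s => [_ x|f s IH hE] /=; first by rewrite inE => /eqP->; rewrite msize1.
rewrite mulnS; apply: msize_powers; first by apply: hE; rewrite mem_head.
by apply: IH => x xs; apply: hE; rewrite inE xs orbT.
Qed.

(** Modulo [var_set C] only the coefficients at monomials in the variables outside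
    [C] count, and the degree bound leaves a box of these. *)
Lemma indep_card C l t : lin_indep (var_set C) l ->
  (forall x, x \in l -> msize x <= t.+1)%N -> (size l <= t.+1 ^ #|~: C|)%N.
Proof.
move=> hl ht.
pose G := pffun_on (ord0 : 'I_t.+1) (mem (~: C)) predT.
have cG : #|G| = (t.+1 ^ #|~: C|)%N by rewrite card_pffun_on card_ord.
pose mon (g : {ffun 'I_n -> 'I_t.+1}) : 'X_{1..n} := [multinom (g i : nat) | i < n].
pose M := \matrix_(i < size l, j < #|G|) (l`_i)@_(mon (enum_val j)).
rewrite -cG leqNgt; apply/negP => lt.
have : kermx M != 0.
  rewrite -mxrank_eq0 mxrank_ker -lt0n subn_gt0; apply: leq_ltn_trans lt.
  exact: rank_leq_col.
move=> /rowV0Pn[v /sub_kermxP vM /negP]; apply; apply/eqP/rowP => k; rewrite mxE.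
pose c i := if insub i is Some k' then v ord0 k' else 0 : K.
have cE (i : 'I_(size l)) : c i = v ord0 i by rewrite /c valK.
rewrite -cE; apply: (hl c) => // m om; rewrite lincombE raddf_sum /=.
under eq_bigr => i _ do rewrite mcoeffZ cE.
case: (ltnP (mdeg m) t.+1) => hm; last first.
  apply: big1 => i _; rewrite memN_msupp_eq0 ?mulr0 //; apply: msize_mdeg_ge.
  by apply: leq_trans hm; apply: ht; apply: mem_nth.
have mlt i : (m i < t.+1)%N.
  by apply: leq_ltn_trans hm; rewrite mdegE (bigD1 i) //= leq_addr.
pose g : {ffun 'I_n -> 'I_t.+1} := [ffun i => Ordinal (mlt i)].
have gG : g \in G.
  apply/pffun_onP; split => //; apply/fintype.subsetP => i.
  rewrite !inE ffunE -val_eqE /=; apply: contra => /(offP _ _ om) -> //.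
have gm : mon g = m by apply/mnmP => i; rewrite mnmE ffunE.
have /rowP/(_ (enum_rank_in gG g)) := vM; rewrite !mxE => e.
rewrite -[RHS]e; apply: eq_bigr => i _; congr (_ * _).
by rewrite mxE enum_rankK_in // gm.
Qed.

(** The [B ^ size s] monomials in [s] are independent and their degree grows linearly
    with [B], so they live in a space of dimension [O(B ^ #|~: C|)]. *)
Theorem indep_bound C J s : isideal J -> var_set C `<=` J -> nz_chain J s ->
  (size s <= #|~: C|)%N.
Proof.
move=> iJ CJ hs; set k := #|~: C|; rewrite leqNgt; apply/negP => lt.
pose E := (\max_(x <- s) msize x)%N.
have hE x : x \in s -> (msize x <= E.+1)%N.
  by move=> xs; apply: leqW; rewrite /E (big_rem x) //= leq_maxl.
(* [B] exceeds [T ^ k], so that [B ^ k.+1] outgrows [(B * T) ^ k] *)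
pose T := (E * size s).+1; pose B := (T ^ k).+1.
have := indep_card (fun c h => monoms_indep (B := B) iJ hs (CJ _ h)) (msize_monoms hE).
rewrite size_monoms -/k; apply/negP; rewrite -ltnNge.
have hT : ((B * E * size s).+1 <= B * T)%N.
  by rewrite /T mulnS -mulnA addnC -addn1 leq_add2l.
apply: (@leq_ltn_trans ((B * T) ^ k)); first by case: (k) => // k'; rewrite leq_exp2r.
rewrite expnMn; apply: (@leq_trans (B ^ k * B)).
  by rewrite ltn_pmul2l ?expn_gt0.
by rewrite -expnSr leq_pexp2l.
Qed.

End MPoly.

(** * Monomial ideals *)

Section MonomialIdeals.
Variables (K : fieldType) (n : nat).
Local Notation S := {mpoly K[n]}.
Implicit Types (p q F : S) (m v w k : 'X_{1..n}) (V W : set 'X_{1..n}).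

Definition up V m := exists2 v, V v & (v <= m)%MM.

Lemma up_le V m k : (m <= k)%MM -> up V m -> up V k.
Proof. by move=> mk [v Vv vm]; exists v => //; apply: lepm_trans mk. Qed.

Lemma isideal_mon V : isideal (mon_ideal (K := K) V).
Proof. exact: isideal_gen. Qed.

Lemma mon_ideal_up V p : mon_ideal V p <-> forall m, m \in msupp p -> up V m.
Proof.
split=> [|h].
  move: p; apply: ideal_gen_min => [|_ [v Vv <-] m]; last first.
    by rewrite msuppX inE => /eqP->; exists v => //; apply: lepm_refl.
  split=> [m|a b ha hb m|a b hb m]; first by rewrite msupp0.
    by move=> /msuppD_le; rewrite mem_cat => /orP[/ha|/hb].
  move=> /msuppM_le /allpairsP[[m1 m2] /= [_ /hb h ->]].
  by apply: up_le h; apply: lem_addl.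
rewrite [p]mpolyE; apply: idl_sum; first exact: isideal_mon.
move=> m /h [v Vv vm]; rewrite -mul_mpolyC -(submK vm) mpolyXD mulrA.
by apply: idlM; [exact: isideal_mon|apply: sub_ideal_gen; exists v].
Qed.

Lemma mon_idealX V m : mon_ideal (K := K) V 'X_[m] <-> up V m.
Proof.
rewrite mon_ideal_up; split=> [h|h m']; first by apply: h; rewrite msuppX mem_head.
by rewrite msuppX inE => /eqP->.
Qed.

Lemma mon_ideal_coeff V p m : mon_ideal V p -> ~ up V m -> p@_m = 0.
Proof.
move=> /mon_ideal_up h um; apply/eqP; rewrite mcoeff_eq0.
by apply/negP => /h.
Qed.

Lemma mon_ideal_sub V W : (forall v, V v -> up W v) ->
  mon_ideal (K := K) V `<=` mon_ideal W.
Proof.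
move=> h p /mon_ideal_up hp; apply/mon_ideal_up => m /hp[v /h uv vm].
exact: up_le uv.
Qed.

Lemma mon_ideal1 V : ~ V 0%MM -> ~ mon_ideal (K := K) V 1.
Proof.
move=> V0; rewrite -mpolyX0 mon_idealX => -[v Vv /mnm_lepP v0]; apply: V0.
suff <- : v = 0%MM by [].
by apply/mnmP => i; apply/eqP; rewrite mnm0E -leqn0 -(mnm0E i).
Qed.

Lemma mcoeffMXif p m k : (p * 'X_[m])@_k = if (m <= k)%MM then p@_(k - m) else 0.
Proof.
case: ifPn => [mk|nmk]; first by rewrite -{1}(submK mk) addmC mcoeffMX.
apply/eqP; rewrite mcoeff_eq0; apply: contra nmk => /msuppM_le.
case/allpairsP => -[m1 m2] /= [_]; rewrite msuppX inE => /eqP-> ->.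
exact: lem_addl.
Qed.

(** Exponents of [x] and [z] that grow together leave no associated prime
    containing both variables. *)
Lemma up_comonotone V (z x : 'I_n) m s t : z != x ->
  (forall v w, V v -> V w -> (v x < w x)%N -> (v z <= w z)%N) ->
  up V (m + U_(z) *+ s)%MM -> up V (m + U_(x) *+ t)%MM -> up V m.
Proof.
move=> zx com [v Vv /mnm_lepP hv] [w Vw /mnm_lepP hw].
have [|nv] := boolP (v <= m)%MM; first by exists v.
have [|nw] := boolP (w <= m)%MM; first by exists w.
have vi i : i != z -> (v i <= m i)%N.
  move=> iz; have := hv i.
  by rewrite mnmDE mulmnE mnm1E eq_sym (negbTE iz) mul0n addn0.
have wi i : i != x -> (w i <= m i)%N.
  move=> ix; have := hw i.
  by rewrite mnmDE mulmnE mnm1E eq_sym (negbTE ix) mul0n addn0.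
have vz : (m z < v z)%N.
  rewrite ltnNge; apply: contra nv => h; apply/mnm_lepP => i.
  by have [->|/vi] := eqVneq i z.
have wx : (m x < w x)%N.
  rewrite ltnNge; apply: contra nw => h; apply/mnm_lepP => i.
  by have [->|/wi] := eqVneq i x.
have := com v w Vv Vw (leq_ltn_trans (vi x _) wx); rewrite eq_sym => /(_ zx) h.
by have := leq_trans vz (leq_trans h (wi z zx)); rewrite ltnn.
Qed.

(** Let [m] be a monomial of [F] outside the ideal with the largest exponent of [z].
    Nothing cancels its product with [z], which therefore lies in the ideal; by
    [up_comonotone] its product with [x ^ d] does not, so it is cancelled by a
    monomial of [F] with one [z] less and [d] more [x]. This repeats until the
    exponent of [z] is exhausted. *)
Theorem comonotone_nzd V (z x : 'I_n) d : z != x ->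
  (forall v w, V v -> V w -> (v x < w x)%N -> (v z <= w z)%N) ->
  nzd (mon_ideal (K := K) V) ('X_z - 'X_x ^+ d).
Proof.
move=> zx com F hF; apply/mon_ideal_up => m0 m0F; apply: contrapT => um0.
have coef k : ~ up V k ->
    (if (U_(z) <= k)%MM then F@_(k - U_(z)) else 0) =
    (if (U_(x) *+ d <= k)%MM then F@_(k - U_(x) *+ d) else 0).
  move=> uk; apply/eqP; rewrite -subr_eq0 -!mcoeffMXif -mcoeffB.
  by rewrite -mpolyXn -mulrBr mulrC (mon_ideal_coeff hF uk).
have xz : (U_(x) : 'X_{1..n})%MM z = 0%N by rewrite mnm1E eq_sym (negbTE zx).
(* pushing a monomial down along the class of [z] and [x ^ d] *)
have down j m t : (m z <= j)%N -> m \in msupp F -> ~ up V m ->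
    up V (m + U_(z) *+ t)%MM -> False.
  elim: j m t => [|j IH] m t mz mF um ut.
    have uk : ~ up V (m + U_(x) *+ d)%MM by move=> h; apply/um/(up_comonotone zx com ut h).
    have := coef _ uk; rewrite lem_addl addmK lep1mP mnmDE mulmnE xz mul0n addn0.
    move: mz; rewrite leqn0 => -> /= /esym/eqP.
    by rewrite mcoeff_eq0 mF.
  have uk : ~ up V (m + U_(x) *+ d)%MM by move=> h; apply/um/(up_comonotone zx com ut h).
  have := coef _ uk; rewrite lem_addl addmK lep1mP mnmDE mulmnE xz mul0n addn0.
  case: eqP => [_ /esym/eqP|/eqP mz0 /= e]; first by rewrite mcoeff_eq0 mF.
  have zk : (U_(z) <= m + U_(x) *+ d)%MM.
    by rewrite lep1mP mnmDE mulmnE xz mul0n addn0.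
  apply: (IH (m + U_(x) *+ d - U_(z))%MM t.+1).
  - by rewrite mnmBE mnmDE mulmnE xz mul0n addn0 mnm1E eqxx leq_subLR add1n.
  - by rewrite mcoeff_msupp e -mcoeff_msupp.
  - by move=> h; apply/uk/(up_le _ h)/lem_subr.
  - apply: up_le ut; rewrite mulmS addmA submK //.
    by apply/mnm_lepP => i; rewrite !mnmDE leq_add2r leq_addr.
pose P := [pred m | (m \in msupp F) && `[< ~ up V m >]].
have exP : exists c, has (fun m => (m z == c) && P m) (msupp F).
  exists (m0 z); apply/hasP; exists m0 => //; rewrite eqxx /= m0F.
  exact/asboolP.
have bP c : has (fun m => (m z == c) && P m) (msupp F) -> (c <= msize F)%N.
  move=> /hasP[m mF /andP[/eqP<- _]]; apply: ltnW.
  by apply: leq_ltn_trans (msize_mdeg_lt mF); rewrite mdegE (bigD1 z) //= leq_addr.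
case: (ex_maxnP exP bP) => c /hasP[m mF /andP[/eqP mv /andP[_ /asboolP um]]] mx.
apply: (down (m z) m 1%N) => //; rewrite mulm1n; apply: contrapT => uk.
have := coef _ uk; rewrite lem_addl addmK; case: ifP => [xk e|_ /eqP]; last first.
  by rewrite mcoeff_eq0 mF.
set m' := (_ - _)%MM in e.
have m'z : m' z = c.+1.
  by rewrite mnmBE mnmDE mulmnE xz mul0n subn0 mnm1E eqxx mv addn1.
suff : (c.+1 <= c)%N by rewrite ltnn.
apply: mx.
apply/hasP; exists m'.
  by rewrite mcoeff_msupp -e -mcoeff_msupp.
rewrite m'z eqxx /= mcoeff_msupp -e -mcoeff_msupp mF /=; apply/asboolP => h.
by apply/uk/(up_le _ h)/lem_subr.
Qed.

End MonomialIdeals.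

(** * Closing the gaps between exponents *)

Section Steps.
Variable n : nat.
Implicit Types (st : nat -> 'I_n * (nat * nat)) (v w u : 'X_{1..n}) (k : 'I_n).

Definition step_var st i : 'I_n := (st i).1.
Definition step_p st i : nat := (st i).2.1.
Definition step_d st i : nat := (st i).2.2.

(** The exponent of [x_k] after [i] steps, as a function of the original generator.
    Keeping it apart from the exponents of the new variables avoids working in
    rings whose number of variables depends on [i]. *)
Fixpoint xexp st i v k : nat :=
  if i is i'.+1 then
    let e := xexp st i' v k in
    if (k == step_var st i') && (step_p st i' < e)%N then (e - step_d st i')%N else e
  else v k.

(** Step [l] is the only one that touches the variable [z_l]. *)
Definition zexp st l v : nat := (step_p st l < xexp st l v (step_var st l))%N.

Definition zcount st i v k : nat := (\sum_(l < i | step_var st l == k) zexp st l v)%N.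

Lemma eq_xexp st st' i v k : (forall l, (l < i)%N -> st l = st' l) ->
  xexp st i v k = xexp st' i v k.
Proof.
elim: i => //= i IH h; rewrite /step_var /step_p /step_d h // IH // => l li.
by apply: h; apply: ltnW.
Qed.

Variable V : seq 'X_{1..n}.

Definition exps st i k := [seq xexp st i v k | v <- V].

Definition tight_row (c : seq nat) := exists l, c =i iota 0 l.+1.

(** The exponents strictly between [p] and [p + d] form the first gap of the row. *)
Definition valid st i := let r := exps st i (step_var st i) in
  let p := step_p st i in let d := step_d st i in
  [/\ forall e, (e <= p)%N -> e \in r, (1 < d)%N, (p + d)%N \in r
    & forall e, e \in r -> (p < e)%N -> (p + d <= e)%N].

Lemma xexp_in st i v k : v \in V -> xexp st i v k \in exps st i k.
Proof. exact: map_f. Qed.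

Section Invariants.
Variables (st : nat -> 'I_n * (nat * nat)) (r : nat).
Hypothesis validst : forall i, (i < r)%N -> valid st i.

Lemma xexp_mono i v w k : (i <= r)%N -> v \in V -> w \in V -> (v k <= w k)%N ->
  (xexp st i v k <= xexp st i w k)%N.
Proof.
elim: i => //= i IH ir vV wV vw; have le := IH (ltnW ir) vV wV vw.
case: eqP => //= ek; have [_ _ _ h] := validst ir.
case: (ltnP (step_p st i) (xexp st i v k)) => hv.
  by rewrite (leq_trans hv le) leq_sub2r.
case: (ltnP (step_p st i) (xexp st i w k)) => // hw.
apply: leq_trans hv _; rewrite leq_subRL; last first.
  apply: leq_trans (h _ _ hw); first exact: leq_addl.
  by rewrite -ek xexp_in.
by rewrite addnC; apply: h => //; rewrite -ek xexp_in.
Qed.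

Lemma zexp_mono l v w : (l < r)%N -> v \in V -> w \in V ->
  (v (step_var st l) <= w (step_var st l))%N -> (zexp st l v <= zexp st l w)%N.
Proof.
move=> lr vV wV vw; rewrite /zexp; case: ltnP => //= hv.
by rewrite (leq_trans hv) // xexp_mono // ltnW.
Qed.

(** A step moves [step_d] units of the exponent of [x_k] into one new variable. *)
Lemma xexp_sum i v k : (i <= r)%N -> v \in V ->
  (xexp st i v k + \sum_(l < i | step_var st l == k) step_d st l * zexp st l v)%N = v k.
Proof.
move=> + vV; elim: i => [|i IH] ir; first by rewrite big_ord0 addn0.
rewrite big_mkcond big_ord_recr -big_mkcond /=; have := IH (ltnW ir).
rewrite [k == _]eq_sym; case: eqP => [ek|_] /= <-; last by rewrite addn0.
have [_ _ _ h] := validst ir.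
have := h (xexp st i v k); rewrite -ek xexp_in ?ek // => /(_ isT).
rewrite /zexp ek; case: ltnP => hv /=; last by lia.
by move=> /(_ isT); lia.
Qed.

Lemma xexp0 i v k : (i <= r)%N -> v \in V -> v k = 0%N ->
  xexp st i v k = 0%N /\ zcount st i v k = 0%N.
Proof.
move=> ir vV vk; have /eqP := xexp_sum k ir vV.
rewrite vk addn_eq0 => /andP[/eqP-> /eqP h]; split => //.
apply/eqP; rewrite -leqn0 -{1}h; apply: leq_sum => l _.
have [_ d1 _ _] := validst (leq_trans (ltn_ord l) ir).
by rewrite leq_pmull // ltnW.
Qed.

(** Between consecutive exponents of [x_k], either the exponent of [x_k] still
    increases, or exactly one of the new variables has absorbed the whole gap. *)
Lemma xexp_jump i v w k : (i <= r)%N -> v \in V -> w \in V -> (v k < w k)%N ->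
  (forall u, u \in V -> (u k <= v k)%N || (w k <= u k)%N) ->
  (xexp st i v k = xexp st i w k /\ zcount st i w k = (zcount st i v k).+1) \/
  ((xexp st i v k < xexp st i w k)%N /\ zcount st i w k = zcount st i v k).
Proof.
move=> + vV wV vw cons; elim: i => [|i IH] ir.
  by right; rewrite /zcount !big_ord0.
have zS u : zcount st i.+1 u k =
    (zcount st i u k + (step_var st i == k) * zexp st i u)%N.
  rewrite /zcount big_mkcond big_ord_recr -big_mkcond /=.
  by case: eqP; rewrite ?mul1n ?mul0n.
rewrite !zS /= eq_sym; case: eqP => [ek|_]; last first.
  by rewrite /= !mul0n !addn0; apply: IH; apply: ltnW.
rewrite /= !mul1n /zexp ek.
have [hp d1 hpd h] := validst ir; rewrite ek in hp hpd h.
have mono u u' : u \in V -> u' \in V -> (u k <= u' k)%N ->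
    (xexp st i u k <= xexp st i u' k)%N.
  by apply: xexp_mono; apply: ltnW.
have big u : u \in V -> (step_p st i < xexp st i u k)%N ->
    (step_p st i + step_d st i <= xexp st i u k)%N.
  by move=> uV; apply: h; apply: xexp_in.
have [[e ->]|[lt ->]] := IH (ltnW ir).
  by left; rewrite e addSn.
case: (ltnP (step_p st i) (xexp st i v k)) => hv.
  right; rewrite (ltn_trans hv lt) /=; split => //.
  apply: ltn_sub2r => //; apply: leq_ltn_trans lt.
  by apply: leq_trans (big _ vV hv); rewrite leq_addl.
case: (ltnP (step_p st i) (xexp st i w k)) => hw; last by right.
left => /=; rewrite addn0 addn1; split => //.
have := big w wV hw; have /mapP[u' u'V eu'] := hpd.
have /mapP[u uV eu] := hp _ (leqnn _).
have ul : (step_p st i <= xexp st i v k)%N.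
  have /orP[/(mono _ _ uV vV)|/(mono _ _ wV uV)] := cons u uV; rewrite -eu //; lia.
have : (xexp st i w k <= step_p st i + step_d st i)%N.
  have /orP[/(mono _ _ u'V vV)|/(mono _ _ wV u'V)] := cons u' u'V; rewrite -eu' //; lia.
lia.
Qed.

(** The left-hand side vanishes at exponent zero and, once the row is tight,
    [xexp_jump] makes it grow by one between consecutive exponents. *)
Lemma shift_rank v k : tight_row (exps st r k) -> (exists2 u, u \in V & u k = 0%N) ->
  v \in V ->
  (xexp st r v k + zcount st r v k)%N = index (v k) (sort leq (undup [seq u k | u <- V])).
Proof.
move=> [top htop] [u0 u0V u00] vV.
set m := sort leq _.
have um : uniq m by rewrite sort_uniq undup_uniq.
have memm e : (e \in m) = (e \in [seq u k | u <- V]) by rewrite mem_sort mem_undup.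
have sm : sorted ltn m.
  by rewrite ltn_sorted_uniq_leq um; apply: sort_sorted; exact: leq_total.
have lt_nth i j : (i < size m)%N -> (j < size m)%N -> (nth 0%N m i < nth 0%N m j)%N = (i < j)%N.
  have hom a b : (b < size m)%N -> (a < b)%N -> (nth 0%N m a < nth 0%N m b)%N.
    by move=> bm ab; apply: (sorted_ltn_nth ltn_trans 0%N sm) => //; apply: ltn_trans bm.
  move=> im jm; have [ij|ji|->] := ltngtP i j; first exact: hom.
    by apply/negbTE; rewrite -leqNgt ltnW // hom.
  by rewrite ltnn.
suff rank i : (i < size m)%N -> forall u, u \in V -> u k = nth 0%N m i ->
    (xexp st r u k + zcount st r u k)%N = i.
  have vm : v k \in m by rewrite memm; apply: map_f.
  by apply: rank; rewrite ?index_mem ?nth_index.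
elim: i => [|i IH] im u uV uk.
  suff u0' : u k = 0%N by have [-> ->] := xexp0 (leqnn r) uV u0'.
  have : 0%N \in m by rewrite memm; apply/mapP; exists u0.
  move=> /(nthP 0%N)[j jm ej]; apply/eqP; rewrite uk -leqn0 leqNgt -{1}ej lt_nth //.
have wm : nth 0%N m i \in m by apply: mem_nth; apply: ltnW.
move: wm; rewrite memm => /mapP[w wV wk].
have wu : (w k < u k)%N by rewrite uk -wk lt_nth // ltnW.
have cons x : x \in V -> (x k <= w k)%N || (u k <= x k)%N.
  move=> xV; have : x k \in m by rewrite memm; apply: map_f.
  move=> /(nthP 0%N)[j jm <-]; rewrite uk -wk; have im' := ltnW im.
  apply/orP; case: (ltnP i j) => h; [right|left].
    by rewrite leqNgt lt_nth // -leqNgt.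
  by rewrite leqNgt lt_nth // -leqNgt.
have IHw := IH (ltnW im) w wV (esym wk).
have [[e1 e2]|[e1 e2]] := xexp_jump (leqnn r) wV uV wu cons; first by lia.
have : xexp st r u k \in exps st r k by apply: xexp_in.
rewrite htop mem_iota /= => hu.
have : (xexp st r w k).+1 \in exps st r k by rewrite htop mem_iota /=; lia.
move=> /mapP[x xV ex].
have /orP[/(xexp_mono (leqnn r) xV wV)|/(xexp_mono (leqnn r) uV xV)] := cons x xV; lia.
Qed.

End Invariants.

Lemma ex_step st i k : (exists2 u, u \in V & xexp st i u k = 0%N) ->
  ~ tight_row (exps st i k) ->
  exists p d, [/\ forall e, (e <= p)%N -> e \in exps st i k, (1 < d)%N,
    (p + d)%N \in exps st i k
    & forall e, e \in exps st i k -> (p < e)%N -> (p + d <= e)%N].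
Proof.
move=> [u uV u0] nt; set c := exps st i k in nt *.
have c0 : 0%N \in c by rewrite -u0; apply: xexp_in.
pose P q := (q \notin c).
have exq : exists q, P q.
  have mx e : e \in c -> (e <= \max_(a <- c) a)%N.
    by move=> ec; rewrite (big_rem e) //= leq_maxl.
  by exists (\max_(e <- c) e).+1; apply/negP => /mx; rewrite ltnn.
case: (ex_minnP exq) => q; rewrite /P => qc minq.
have q0 : (0 < q)%N by rewrite lt0n; apply/negP => /eqP e; rewrite e c0 in qc.
have low e : (e < q)%N -> e \in c.
  by move=> eq; apply/negPn/negP => /minq; rewrite leqNgt eq.
have exl : exists e, (e \in c) && (q < e)%N.
  apply: contrapT => no; apply: nt; exists q.-1 => e; rewrite mem_iota /= add0n prednK //.
  apply/idP/idP => [ec|]; last exact: low.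
  have [//|qe|e_q] := ltngtP e q; last by rewrite e_q (negbTE qc) in ec.
  by case: no; exists e; rewrite ec.
case: (ex_minnP exl) => e1 /andP[e1c qe1] mine1.
(* [q] is the least missing exponent and [e1] the least one beyond it *)
exists q.-1, (e1 - q.-1)%N; split.
- by move=> e eq; apply: low; rewrite -(prednK q0) ltnS.
- by lia.
- by have -> : (q.-1 + (e1 - q.-1))%N = e1 by lia.
- move=> e ec lt; have -> : (q.-1 + (e1 - q.-1))%N = e1 by lia.
  apply: mine1; rewrite ec /= ltn_neqAle; apply/andP; split; last by lia.
  by apply/eqP => eq; rewrite eq ec in qc.
Qed.

(** Every step lowers some exponent of an [x] variable. *)
Theorem ex_full_steps (k0 : 'I_n) : (forall k, exists2 v, v \in V & v k = 0%N) ->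
  exists st r, (forall i, (i < r)%N -> valid st i) /\
    forall k, tight_row (exps st r k).
Proof.
move=> zero; pose mu st i := (\sum_(v <- V) \sum_k xexp st i v k)%N.
suff H m st i : (mu st i < m)%N -> (forall l, (l < i)%N -> valid st l) ->
    exists st' r, (forall l, (l < r)%N -> valid st' l) /\
    forall k, tight_row (exps st' r k).
  by apply: (H _ (fun=> (k0, (0%N, 0%N))) 0%N (ltnSn _)).
elim: m st i => // m IH st i lt val.
have [|/existsNP[k nt]] := pselect (forall k, tight_row (exps st i k)).
  by move=> h; exists st, i.
have [|p [d [h1 h2 h3 h4]]] := @ex_step st i k _ nt.
  by have [v vV vk] := zero k; exists v => //; have [] := xexp0 val (leqnn i) vV vk.
pose st' l := if l == i then (k, (p, d)) else st l.
have st'l l : (l < i)%N -> st l = st' l by rewrite /st' => /ltn_eqF->.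
have ex' l v a : (l <= i)%N -> xexp st' l v a = xexp st l v a.
  by move=> li; apply/esym/eq_xexp => b bl; apply: st'l; apply: leq_trans li.
have er l a : (l <= i)%N -> exps st' l a = exps st l a.
  by move=> li; apply: eq_map => v; apply: ex'.
have [sv sp sd] : [/\ step_var st' i = k, step_p st' i = p & step_d st' i = d].
  by rewrite /step_var /step_p /step_d /st' eqxx.
apply: (IH st' i.+1) => [|l]; last first.
  rewrite ltnS leq_eqVlt => /orP[/eqP->|li].
    by rewrite /valid sv sp sd er.
  have := val l li; rewrite /valid er; last exact: ltnW.
  by rewrite /step_var /step_p /step_d -st'l.
rewrite ltnS in lt; apply: leq_trans lt; have /mapP[w wV ew] := h3.
have le v a : (xexp st' i.+1 v a <= xexp st i v a)%N.
  by rewrite /= ex' //; case: ifP => // _; apply: leq_subr.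
rewrite /mu ![(\sum_(v <- V) _)%N](big_rem w) //= -addSn.
apply: leq_add; last by apply: leq_sum => v _; apply: leq_sum => a _; apply: le.
rewrite ![(\sum_a _)%N](bigD1 k) //= -addSn.
apply: leq_add; last by apply: leq_sum => a _; apply: le.
by rewrite sv sp sd eqxx ex' //= -ew; case: ifP; lia.
Qed.
End Steps.

(** * Heights and dimensions of monomial ideals *)

Section Quotients.
Variables (A : comNzRingType) (I : idealr A).
Local Notation Q := {ideal_quot I}.
Local Notation pi := (\pi_Q : A -> Q).

Lemma pi_eq a b : pi a = pi b <-> [set` I] (a - b).
Proof. by rewrite /= Quotient.idealrBE; split => [->|/eqP]. Qed.

Lemma pi0 a : pi a = 0 <-> [set` I] a.
Proof. by rewrite -(rmorph0 (\pi_Q : {rmorphism A -> Q})) pi_eq subr0. Qed.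

(** Reduces regular sequences on the quotient to computations in [A]. *)
Lemma ideal_gen_pi s a :
  ideal_gen [set` [seq pi x | x <- s]] (pi a) <-> extl [set` I] s a.
Proof.
have iI := isideal_idealr I.
split=> [h|].
  pose T : set Q := [set q | exists2 b, q = pi b & extl [set` I] s b].
  have iE := isideal_extl s iI.
  have : T (pi a).
    move: (pi a) h; apply: ideal_gen_min; last first.
      by move=> _ /= /mapP[x xs ->]; exists x => //; apply: extl_gen.
    split.
    - by exists 0; [rewrite rmorph0|apply: idl0].
    - move=> _ _ [b -> hb] [c -> hc]; exists (b + c); first by rewrite rmorphD.
      exact: idlD.
    - move=> q _ [b -> hb]; exists (repr q * b); last exact: idlM.
      by rewrite rmorphM /= reprK.
  move=> [b /pi_eq h1 h2]; rewrite -(subrK b a); apply: idlD => //.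
  exact: sub_extl.
move: a; apply: extl_min => [|a Ia|x xs] /=.
- split; rewrite /= ?rmorph0; first exact: (idl0 (isideal_gen _)).
    by move=> a b; rewrite rmorphD; apply: idlD; apply: isideal_gen.
  by move=> a b; rewrite rmorphM; apply: idlM; apply: isideal_gen.
- by rewrite (pi0 a).2 //; apply: (idl0 (isideal_gen _)).
- by apply: sub_ideal_gen; rewrite /= map_f.
Qed.

Lemma quot_regular_seqP s :
  quot_regular_seq I s <-> wreg [set` I] s /\ ~ extl [set` I] s 1.
Proof.
have key i a : (i < size s)%N ->
    (ideal_gen [set` take i [seq pi x | x <- s]] (([seq pi x | x <- s])`_i * pi a) <->
     extl [set` I] (take i s) (s`_i * a)) /\
    (ideal_gen [set` take i [seq pi x | x <- s]] (pi a) <->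
     extl [set` I] (take i s) a).
  move=> is_; rewrite -map_take (nth_map 0) // -ideal_gen_pi -ideal_gen_pi.
  by rewrite rmorphM.
rewrite wregP; split=> -[h1 h2]; split.
- move=> i is_ a ha; apply/(key i a is_).2; apply: h1; first by rewrite size_map.
  exact/(key i a is_).1.
- move=> h; apply: h2; apply/seteqP; split => // q _; rewrite -(mulr1 q).
  apply: idlM; first exact: isideal_gen.
  by have /ideal_gen_pi := h; rewrite rmorph1.
- move=> i q; rewrite size_map => is_; rewrite -(reprK q) => ha.
  by apply/(key i _ is_).2; apply: h1 => //; apply/(key i _ is_).1.
- by move=> e; apply: h2; apply/ideal_gen_pi; rewrite e.
Qed.

Definition set_chain (B : comNzRingType) (k : nat) (P : nat -> set B) :=
  (forall i, prime_set (P i)) /\ forall i, (i < k)%N -> P i `<` P i.+1.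

Lemma prime_set_pre (P : set Q) : prime_set P -> prime_set [set a | P (pi a)].
Proof.
move=> [iP P1 pP]; split => /=.
- split=> [|a b|a b] /=; rewrite ?rmorph0 ?rmorphD ?rmorphM.
  + exact: idl0.
  + exact: idlD.
  + exact: idlM.
- by rewrite rmorph1.
- by move=> a b; rewrite rmorphM; apply: pP.
Qed.

Lemma prime_set_image (P : set A) : [set` I] `<=` P -> prime_set P ->
  prime_set [set q : Q | P (repr q)] /\ forall a, P (repr (pi a)) <-> P a.
Proof.
move=> IP [iP P1 pP].
have key a : P (repr (pi a)) <-> P a.
  have h : P (repr (pi a) - a) by apply/IP/pi_eq; rewrite reprK.
  split=> ha; last by rewrite -(subrK a (repr _)); apply: idlD.
  by rewrite -(subKr (repr (pi a)) a); apply: idlB.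
split=> //; split => /=.
- split=> [|a b|a b] /=; first by rewrite -(rmorph0 (\pi_Q : {rmorphism A -> Q})) key; apply: idl0.
    by move=> ha hb; rewrite -{1}(reprK a) -{1}(reprK b) -rmorphD key; exact: idlD.
  by rewrite -{1}(reprK a) -{2}(reprK b) -rmorphM key; apply: idlM.
- by rewrite -(rmorph1 (\pi_Q : {rmorphism A -> Q})) key.
- by move=> a b; rewrite -{1}(reprK a) -{1}(reprK b) -rmorphM key; apply: pP.
Qed.

Lemma krull_dim_quot d : (exists2 P, set_chain d P & [set` I] `<=` P 0%N) ->
  (forall k P, set_chain k P -> [set` I] `<=` P 0%N -> (k <= d)%N) ->
  krull_dim Q d.
Proof.
move=> [P [pP sP] IP0] ub; split; last first.
  move=> k P' cP'; apply: (ub k (fun i => [set a | pi a \in P' i])).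
    split=> [i|i ik]; first exact: (prime_set_pre (prime_set_idealr (P' i))).
    have [s1 s2] := cP' i ik; split => [a|s]; first exact: s1.
    by apply: s2 => q; rewrite /= -(reprK q); apply: s.
  by move=> a /pi0 /= ->; apply: idealr0.
have {}pP : forall i, exists P' : prime_idealr A, [set` P'] = P i.
  by move=> i; have [P' e] := ex_prime_idealr (pP i); exists P'.
have sub i : (i <= d)%N -> [set` I] `<=` P i.
  elim: i => // i IH id_ a /(IH (ltnW id_)); exact: (sP i id_).1.
have ex i : exists P' : prime_idealr Q,
    (i <= d)%N -> forall a, pi a \in P' <-> P i a.
  have prime_over j : (j <= d)%N -> exists P' : prime_idealr Q,
      forall a, pi a \in P' <-> P j a.
    move=> jd; have pPj : prime_set (P j) by have [P' <-] := pP j; apply: prime_set_idealr.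
    have [pI key] := prime_set_image (sub j jd) pPj.
    have [P'' e] := ex_prime_idealr pI; exists P'' => a; rewrite -key.
    by move/seteqP: e => [e1 e2]; split => [/e1|/e2].
  case: (leqP i d) => [/prime_over[P' h]|_]; first by exists P'.
  by have [P' _] := prime_over 0%N isT; exists P'.
have [P' hP'] := choice ex.
exists P' => i id_; have [s1 s2] := sP i id_; split.
  move=> q /=; rewrite -(reprK q) !hP' //; [exact: s1|exact: ltnW].
move=> s; apply: s2 => a; rewrite -!hP' //; [exact: s|exact: ltnW].
Qed.

End Quotients.

Section MonomialHeights.
Variables (K : fieldType) (n : nat).
Local Notation S := {mpoly K[n]}.
Implicit Types (C D : {set 'I_n}) (V : set 'X_{1..n}).

(** Modulo a prime, every element outside it is regular. *)
Lemma set_chain_nz (k : nat) (P : nat -> set S) : set_chain k P ->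
  exists2 s, size s = k & nz_chain (P 0%N) s.
Proof.
elim: k P => [|k IH] P [pP sP]; first by exists [::] => //=; have [] := pP 0%N.
have [|s sk cs] := IH (fun i => P i.+1).
  by split=> [i|i ik]; [exact: pP|exact: sP].
have [s1 /existsNP[f /not_implyP[P1f P0f]]] := sP 0%N isT.
exists (f :: s); first by rewrite /= sk.
split; first by move=> a; have [_ _ p0] := pP 0%N; move/p0 => -[].
have [i1 _ _] := pP 1%N.
by exists (P 1%N); split => //; apply: ext_min.
Qed.

Lemma set_chain_bound k (P : nat -> set S) C : set_chain k P ->
  var_set C `<=` P 0%N -> (k <= #|~: C|)%N.
Proof.
move=> cP sub; have [s <- cs] := set_chain_nz cP.
by apply: indep_bound sub cs; have [] := cP.1 0%N.
Qed.

Lemma set_chain_cat k k' (P P' : nat -> set S) : set_chain k P -> set_chain k' P' ->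
  P k = P' 0%N -> exists2 R, set_chain (k + k') R & R 0%N = P 0%N.
Proof.
move=> [pP sP] [pP' sP'] e.
exists (fun i => if (i <= k)%N then P i else P' (i - k)%N) => //.
split=> [i|i ik]; first by case: ifP.
case: (ltngtP i k) ik => [ik' _|ki ik|-> ik]; first exact: sP.
  by rewrite subSn; [apply: sP'; rewrite ltn_subLR // ltnW|exact: ltnW].
by rewrite e subSnn; apply: sP'; lia.
Qed.

Lemma set_chain_cons k (P : nat -> set S) (P0 : set S) : prime_set P0 ->
  set_chain k P -> P0 `<` P 0%N ->
  set_chain k.+1 (fun i => if i is i'.+1 then P i' else P0).
Proof. by move=> p0 [pP sP] lt; split=> [[|i]|[|i]] //; apply: sP. Qed.

Lemma var_chain C D : C \subset D -> exists P : nat -> set S,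
  [/\ set_chain (#|D| - #|C|) P, P 0%N = var_set C
    & P (#|D| - #|C|)%N = var_set D].
Proof.
move e : (#|D| - #|C|)%N => k; elim: k C e => [|k IH] C e CD.
  have -> : C = D by apply/eqP; rewrite eqEcard CD -subn_eq0 e.
  by exists (fun=> var_set D); split => //; split => // i; apply: var_set_prime.
have /properP[_ [x xD xC]] : C \proper D by rewrite properEcard CD -subn_gt0 e.
have [||P [cP P0 Pk]] := IH (x |: C).
- by rewrite cardsU1 xC add1n subnS e.
- by rewrite finset.subUset finset.sub1set xD.
exists (fun i => if i is i'.+1 then P i' else var_set C); split => //.
apply: set_chain_cons => //; first exact: var_set_prime.
rewrite P0; split; first by apply: var_set_sub; apply: finset.subsetUr.
move=> /(_ 'X_x); rewrite !var_setX => h; move: xC; rewrite h //.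
exact: finset.setU11.
Qed.

Definition vertex_cover V C := forall v, V v -> ~~ off C v.

Lemma cover_sub V C : vertex_cover V C -> mon_ideal V `<=` @var_set K n C.
Proof.
move=> cov p /mon_ideal_up h m om; apply/eqP; rewrite mcoeff_eq0.
apply/negP => /h[v /cov /offPn[i iC vi] /mnm_lepP/(_ i)].
by rewrite (offP _ _ om) // leqn0 (negbTE vi).
Qed.

(** A prime that contains a monomial contains one of its variables. *)
Lemma prime_cover V (P : set S) : prime_set P -> mon_ideal V `<=` P ->
  exists D, vertex_cover V D /\ var_set D `<=` P.
Proof.
move=> [iP P1 pP] sub; pose D := finset (fun i => `[< P 'X_i >]).
have DP i : i \in D <-> P 'X_i by rewrite inE; split=> /asboolP.
exists D; split; last by apply: var_set_min => // i /DP.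
move=> v Vv; apply/negP => /offP od.
have : P 'X_[v] by apply: sub; apply/mon_idealX; exists v => //; apply: lepm_refl.
rewrite mpolyXE_id; apply: (big_ind (fun y => ~ P y)) => //.
  by move=> x y Px Py /pP[].
move=> i _; case: (eqVneq (v i) 0%N) => [->//|vi].
have {vi} Pi : ~ P 'X_i by move=> /DP/od h; rewrite h in vi.
by elim: (v i) => // l IH; rewrite exprS => /pP[].
Qed.

Lemma ex_min_cover V : ~ V 0%MM ->
  exists2 C, vertex_cover V C & forall D, vertex_cover V D -> (#|C| <= #|D|)%N.
Proof.
move=> V0; have covT : `[< vertex_cover V finset.setT >].
  apply/asboolP => v Vv; apply/negP => /offP h; apply: V0.
  suff <- : v = 0%MM by [].
  by apply/mnmP => i; rewrite mnm0E h // finset.in_setT.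
case: (@arg_minnP _ finset.setT (fun C => `[< vertex_cover V C >]) (fun C : {set 'I_n} => #|C|) covT).
by move=> C /asboolP cC hC; exists C => // D cD; apply/hC/asboolP.
Qed.

Lemma set_chain_idealr k (P : nat -> set S) : set_chain k P ->
  exists2 P' : nat -> prime_idealr S, prime_chain k P' & forall i, [set` P' i] = P i.
Proof.
move=> [pP sP].
have ex i : exists P' : prime_idealr S, [set` P'] = P i.
  by have [P' e] := ex_prime_idealr (pP i); exists P'.
by have [P' e] := choice ex; exists P' => // i ik; rewrite !e; apply: sP.
Qed.

Lemma prime_chain_set k (P : nat -> prime_idealr S) : prime_chain k P ->
  set_chain k (fun i => [set` P i]).
Proof. by move=> cP; split=> [i|]; [exact: prime_set_idealr|exact: cP]. Qed.

(** A chain that ends at [var_set C] is prolonged by adjoining the other variables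
    one at a time, and [set_chain_bound] limits the total length by [n]. *)
Lemma height_cover (J : idealr S) V C : [set` J] = mon_ideal V -> vertex_cover V C ->
  (forall D, vertex_cover V D -> (#|C| <= #|D|)%N) -> height J #|C|.
Proof.
move=> eJ cC hC; split.
  have [Q eQ] := ex_prime_idealr (var_set_prime K C); exists Q.
    move=> x xJ; have : [set` J] x by [].
    by rewrite eJ => /(cover_sub cC); rewrite -eQ.
  split.
    have [P] := var_chain (finset.sub0set C); rewrite cards0 subn0 => -[cP P0 Ph].
    have [P' cP' e] := set_chain_idealr cP; exists P' => //.
    move=> x; apply/idP/idP => xx; [have : [set` P' #|C|] x by []|have : [set` Q] x by []].
      by rewrite e Ph -eQ.
    by rewrite eQ -Ph -e.
  move=> k P /prime_chain_set cP PQ.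
  have [P' [cP' P'0 _]] := var_chain (finset.subsetT C).
  have [|R cR R0] := set_chain_cat cP cP'.
    by rewrite P'0 -eQ; apply/seteqP; split => x /=; rewrite PQ.
  have := set_chain_bound (C := finset.set0) cR _; rewrite R0.
  rewrite finset.setC0 cardsT card_ord.
  suff h : var_set finset.set0 `<=` [set` P 0%N].
    move/(_ h); have := max_card (mem C); rewrite card_ord; lia.
  by apply: var_set_min; [exact: isideal_idealr|move=> i; rewrite finset.in_set0].
move=> Q k JQ [_ Qk].
have [|D [cD DQ]] := @prime_cover V [set` Q] (prime_set_idealr Q).
  by rewrite -eJ => x /= xJ; apply: JQ.
apply: leq_trans (hC D cD) _.
have [P] := var_chain (finset.sub0set D); rewrite cards0 subn0 => -[[pP sP] P0 Ph].
(* the top of the chain below [var_set D] is replaced by [Q] itself *)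
pose P1 i := if (i < #|D|)%N then P i else [set` Q].
have cP1 : set_chain #|D| P1.
  split=> [i|i iD]; first by rewrite /P1; case: ifP => // _; apply: prime_set_idealr.
  rewrite /P1 iD; case: ltnP => h; first exact: sP.
  have [s1 s2] := sP i iD.
  have ei : i.+1 = #|D| by apply/eqP; rewrite eqn_leq iD.
  rewrite ei Ph in s1 s2.
  by split=> [x /s1/DQ|s] //; apply: s2 => x /DQ /s.
have [P' cP' e] := set_chain_idealr cP1; apply: (Qk _ P' cP').
move=> x; have e' := e #|D|; rewrite /P1 ltnn in e'.
by move/seteqP: e' => [h1 h2]; apply/idP/idP => [/h1|/h2].
Qed.

Lemma height_uniq (J : idealr S) h h' : height J h -> height J h' -> h = h'.
Proof.
by move=> [[Q JQ Qh] lh] [[Q' JQ' Qh'] lh']; apply/eqP;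
  rewrite eqn_leq (lh Q' h') ?(lh' Q h).
Qed.

Lemma mon_idealr_n0 (J : idealr S) V : [set` J] = mon_ideal V -> ~ V 0%MM.
Proof.
move=> eJ V0; have : [set` J] 1.
  by rewrite eJ -mpolyX0; apply/mon_idealX; exists 0%MM => //; apply: lepm_refl.
by rewrite /= idealr1.
Qed.

Lemma height_coverP (J : idealr S) V h : [set` J] = mon_ideal V -> height J h ->
  exists2 C, vertex_cover V C /\ #|C| = h & forall D, vertex_cover V D -> (h <= #|D|)%N.
Proof.
move=> eJ hJ; have [C cC hC] := ex_min_cover (mon_idealr_n0 eJ).
have e := height_uniq (height_cover eJ cC hC) hJ.
by exists C => //; rewrite -e.
Qed.

(** Any prime over [J] contains the [var_set] of a cover, so chains above it are
    bounded by the number of variables outside that cover. *)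
Lemma krull_dim_cover (J : idealr S) V C : [set` J] = mon_ideal V -> vertex_cover V C ->
  (forall D, vertex_cover V D -> (#|C| <= #|D|)%N) -> krull_dim {ideal_quot J} (n - #|C|)%N.
Proof.
move=> eJ cC hC; apply: krull_dim_quot.
  have [P] := var_chain (finset.subsetT C); rewrite cardsT card_ord => -[cP P0 _].
  by exists P => //; rewrite P0 eJ; apply: cover_sub.
move=> k P cP; rewrite eJ => sub; have [D [cD DP]] := prime_cover (cP.1 0%N) sub.
apply: leq_trans (set_chain_bound cP DP) _; rewrite [#|~: D|]cardsCs finset.setCK card_ord.
by rewrite leq_sub2l // hC.
Qed.

End MonomialHeights.

(** * Minimal generators along the polarization *)

Section Generators.
Variables (K : fieldType).

Lemma entries_incidence N (W : seq 'X_{1..N}) a :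
  entries (row a (incidence_mx W)) = [seq fun_of_multinom w a | w <- W].
Proof.
rewrite /entries; transitivity [seq fun_of_multinom w a | w <- tval (in_tuple W)] => //.
rewrite -[in RHS]map_tnth_enum -map_comp.
by apply: eq_map => i /=; rewrite !mxE.
Qed.

Lemma tight_rowE N (W : seq 'X_{1..N}) a :
  tight (row a (incidence_mx W)) <-> tight_row [seq fun_of_multinom w a | w <- W].
Proof. by rewrite /tight entries_incidence. Qed.

Definition antichain N (W : seq 'X_{1..N}) :=
  forall v w, v \in W -> w \in W -> (v <= w)%MM -> v = w.

Lemma min_gens_antichain N (I : idealr {mpoly K[N]}) (W : seq 'X_{1..N}) :
  min_gens I W <-> [/\ uniq W, [set` I] = mon_ideal [set` W] & antichain W].
Proof.
split=> -[uW eI h]; split=> //.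
  move=> v w vW wW vw; apply/eqP/negPn/negP => v_w.
  have sub : {subset rem w W <= W} by move=> x; apply: mem_rem.
  have /(_ w wW) : {subset W <= rem w W}.
    apply: h => //; rewrite eI; apply/seteqP; split; apply: mon_ideal_sub => x /= xW.
      have [->|xw] := eqVneq x w; [exists v|exists x] => //=; last exact: lepm_refl.
        by rewrite mem_rem_uniq // inE v_w.
      by rewrite mem_rem_uniq // inE xw.
    by exists x; [exact: sub|exact: lepm_refl].
  by rewrite mem_rem_uniq // inE eqxx.
move=> W' sub e v vW.
have : mon_ideal (K := K) [set` W'] 'X_[v].
  by rewrite -e eI; apply/mon_idealX; exists v => //; apply: lepm_refl.
by move=> /mon_idealX[w /= wW' wv]; rewrite -(h w v (sub w wW') vW wv).
Qed.

(** Dickson's lemma makes the set of minimal exponents finite. *)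
Lemma ex_min_gens N (I : idealr {mpoly K[N]}) : monomial_ideal I ->
  exists W, min_gens I W.
Proof.
move=> [V eI]; pose Min v := V v /\ forall w, V w -> (w <= v)%MM -> w = v.
have below v : V v -> exists2 w, Min w & (w <= v)%MM.
  have [k] := ubnP (mdeg v); elim: k v => // k IH v lt Vv.
  have [mv|/not_andP[//|/existsNP[w /not_implyP[Vw /not_implyP[wv nwv]]]]] := pselect (Min v).
    by exists v => //; apply: lepm_refl.
  have [|u Mu uw] := IH w _ Vw; last by exists u => //; apply: lepm_trans wv.
    rewrite ltnS in lt; apply: leq_trans lt; rewrite -(submK wv) mdegD -add1n leq_add2r.
    rewrite lt0n mdeg_eq0; apply/eqP => e; apply: nwv.
    by rewrite -(submK wv) e add0m.
have [s hs] : exists s : seq 'X_{1..N}, forall v, Min v -> v \in s.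
  apply: contrapT => no.
  have ex (s : seq 'X_{1..N}) : exists v, Min v /\ v \notin s.
    apply: contrapT => nv; apply: no; exists s => v Mv.
    by apply/negPn/negP => vs; apply: nv; exists v.
  have [f fP] := choice ex.
  pose L := fix L i := if i is i'.+1 then f (L i') :: L i' else [::].
  have [i [j [ij le]]] := dickson (fun i => f (L i)).
  have inL : f (L i) \in L j.
    elim: j ij {le} => // j IH; rewrite ltnS leq_eqVlt => /orP[/eqP->|/IH h].
      exact: mem_head.
    by rewrite /= inE h orbT.
  have [Mi _] := fP (L i); have [Mj nj] := fP (L j).
  by rewrite -(Mj.2 _ Mi.1 le) inL in nj.
exists (undup [seq v <- s | `[< Min v >]]); apply/min_gens_antichain.
have memW v : v \in undup [seq v <- s | `[< Min v >]] <-> Min v.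
  rewrite mem_undup mem_filter; split=> [/andP[/asboolP]//|Mv].
  by rewrite hs // andbT; apply/asboolP.
split; first exact: undup_uniq.
  rewrite eI; apply/seteqP; split; apply: mon_ideal_sub => v.
    by move=> /below[w /memW Mw wv]; exists w.
  by move=> /memW[Vv _]; exists v => //; apply: lepm_refl.
by move=> v w /memW Mv /memW[_ Mw]; apply: Mw; case: Mv.
Qed.

Definition mon_idealr N (W : seq 'X_{1..N}) (W0 : 0%MM \notin W) : idealr {mpoly K[N]} :=
  projT1 (ex_idealr (isideal_mon K [set` W]) (mon_ideal1 (K := K) (negP W0))).

Lemma mon_idealrE N (W : seq 'X_{1..N}) (W0 : 0%MM \notin W) :
  [set` mon_idealr W0] = mon_ideal [set` W].
Proof. exact: (projT2 (ex_idealr _ _)). Qed.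

End Generators.

Section Polarize.
Variable n : nat.
Implicit Types (st : nat -> 'I_n * (nat * nat)) (v w u : 'X_{1..n}) (k : 'I_n).

Lemma xvar_widen i k : xvar i.+1 k = widen_ord (leqnSn (i + n)) (xvar i k) :> 'I_(i + n).+1.
Proof. exact: val_inj. Qed.

Lemma zvar_widen i (l : 'I_i) :
  zvar n (widen_ord (leqnSn i) l) = widen_ord (leqnSn (i + n)) (zvar n l) :> 'I_(i + n).+1.
Proof. exact: val_inj. Qed.

Lemma zvar_max i : zvar n (ord_max : 'I_i.+1) = ord_max :> 'I_(i + n).+1.
Proof. by apply: val_inj; rewrite /= addnC. Qed.

Variant var_spec i : 'I_(i + n) -> Type :=
  | IsXvar k : var_spec (xvar i k)
  | IsZvar l : var_spec (zvar n l).

Lemma varP i a : @var_spec i a.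
Proof.
have e : a = cast_ord (addnC n i) (cast_ord (addnC i n) a) by apply: val_inj.
rewrite e; case: (split_ordP (cast_ord (addnC i n) a)) => b ->.
  exact: IsXvar.
exact: IsZvar.
Qed.

Lemma xvar_inj i : injective (xvar (n := n) i).
Proof. by move=> a b /(congr1 val) /= /val_inj. Qed.

Lemma zvar_inj i : injective (zvar n (r := i)).
Proof. by move=> a b /(congr1 val) /= /addnI /val_inj. Qed.

Lemma xz_neq i k (l : 'I_i) : (xvar i k == zvar n l) = false.
Proof.
by apply/negbTE; rewrite -val_eqE /= neq_ltn (leq_trans (ltn_ord k)) ?leq_addr.
Qed.

Lemma polarize_widen N (k a : 'I_N) p d (v : 'X_{1..N}) :
  polarize_mon k p d v (widen_ord (leqnSn N) a) =
  (if (a == k) && (p < v k) then v a - d else v a)%N.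
Proof.
rewrite /polarize_mon; case: leqP => h; first by rewrite mnmwiden_widen andbF.
rewrite mnmDE mnmwiden_widen mnmBE mulmnE !mnm1E andbT eq_sym.
have -> : (widen_ord (leqnSn N) a == ord_max) = false.
  by rewrite -val_eqE /= ltn_eqF.
by rewrite [k == a]eq_sym; case: eqP; rewrite ?mul1n // mul0n subn0.
Qed.

Lemma polarize_max N (k : 'I_N) p d (v : 'X_{1..N}) :
  polarize_mon k p d v ord_max = (p < v k)%N.
Proof.
rewrite /polarize_mon; case: leqP => h; first exact: mnmwiden_ordmax.
by rewrite mnmDE mnmwiden_ordmax mnm1E eqxx.
Qed.

Fixpoint pol st i v : 'X_{1..i + n} :=
  if i is i'.+1 then
    polarize_mon (xvar i' (step_var st i')) (step_p st i') (step_d st i') (pol st i' v)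
  else v.

Lemma pol_x st i v k : pol st i v (xvar i k) = xexp st i v k.
Proof.
elim: i k => [|i IH] k; first by rewrite /=; congr (fun_of_multinom v _); apply: val_inj.
rewrite xvar_widen /= polarize_widen (inj_eq (@xvar_inj i)) !IH.
by case: eqP => //= ->.
Qed.

Lemma pol_z st i v (l : 'I_i) : pol st i v (zvar n l) = zexp st l v.
Proof.
elim: i l => [[]//|i IH] l; case: (unliftP ord_max l) => [l' ->|->]; last first.
  by rewrite zvar_max /= polarize_max pol_x.
have -> : lift ord_max l' = widen_ord (leqnSn i) l' by apply: val_inj; exact: lift_max.
rewrite zvar_widen /= polarize_widen IH.
by rewrite [zvar _ _ == _]eq_sym xz_neq.
Qed.

Section Process.
Variables (K : fieldType) (V : seq 'X_{1..n}) (st : nat -> 'I_n * (nat * nat)) (r : nat).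
Hypothesis validst : forall i, (i < r)%N -> valid V st i.
Hypothesis antiV : antichain V.
Hypothesis uniqV : uniq V.
Hypothesis zeroV : forall k, exists2 v, v \in V & v k = 0%N.

Definition pols i := [seq pol st i v | v <- V].

Lemma pol_n0 i v : v != 0%MM -> pol st i v != 0%MM.
Proof.
move=> v0; elim: i => //= i IH; apply/eqP => e.
have := polarize_max (xvar i (step_var st i)) (step_p st i) (step_d st i) (pol st i v).
rewrite e mnm0E; case: ltnP => // le _; move: e.
rewrite /polarize_mon le -(mnmwiden0 (i + n)) => /inj_mnmwiden /eqP.
by rewrite (negbTE IH).
Qed.

Lemma pols_n0 i : 0%MM \notin V -> 0%MM \notin pols i.
Proof.
move=> V0; apply/negP => /mapP[v vV /esym/eqP]; apply/negP/pol_n0.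
by apply/eqP => e; rewrite e in vV; rewrite vV in V0.
Qed.

(** The new exponents recombine to the old ones by [xexp_sum]. *)
Lemma pol_le i v w : (i <= r)%N -> v \in V -> w \in V ->
  (pol st i v <= pol st i w)%MM -> (v <= w)%MM.
Proof.
move=> ir vV wV /mnm_lepP h; apply/mnm_lepP => k.
rewrite -(xexp_sum validst k ir vV) -(xexp_sum validst k ir wV) leq_add //.
  by rewrite -!pol_x.
by apply: leq_sum => l _; rewrite leq_mul2l -!pol_z h orbT.
Qed.

Lemma pols_min_gens i (I : idealr {mpoly K[i + n]}) : (i <= r)%N ->
  [set` I] = mon_ideal [set` pols i] -> min_gens I (pols i).
Proof.
move=> ir eI; apply/min_gens_antichain; split => //.
  rewrite map_inj_in_uniq // => v w vV wV e.
  by apply: antiV => //; apply: (pol_le ir) => //; rewrite e; apply: lepm_refl.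
move=> _ _ /mapP[v vV ->] /mapP[w wV ->] /(pol_le ir vV wV) /(antiV vV wV) -> //.
Qed.

Lemma exps_pols i k : [seq fun_of_multinom m (xvar i k) | m <- pols i] = exps V st i k.
Proof. by rewrite -map_comp; apply: eq_map => v /=; rewrite pol_x. Qed.

Lemma pols_zero i a : (i <= r)%N -> 0%N \in [seq fun_of_multinom m a | m <- pols i].
Proof.
move=> ir; case: (varP a) => [k|l]; rewrite -map_comp.
  have [v vV vk] := zeroV k; apply/mapP; exists v => //=.
  by rewrite pol_x; have [] := xexp0 validst ir vV vk.
have [v vV vk] := zeroV (step_var st l); apply/mapP; exists v => //=.
have lr : (l <= r)%N by rewrite ltnW // (leq_trans (ltn_ord l)).
by rewrite pol_z /zexp; have [->] := xexp0 validst lr vV vk.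
Qed.

Lemma pols_step i (I : idealr {mpoly K[i + n]}) (J : idealr {mpoly K[i.+1 + n]}) :
  (i < r)%N -> [set` I] = mon_ideal [set` pols i] ->
  [set` J] = mon_ideal [set` pols i.+1] ->
  @partial_polarization K (i + n) I (xvar i (step_var st i)) (step_d st i) J.
Proof.
move=> ir eI eJ; exists (pols i); first exact: pols_min_gens (ltnW ir) eI.
have [h1 h2 h3 h4] := validst ir.
have rowE a : entries (row a (incidence_mx (pols i))) =
    [seq fun_of_multinom m a | m <- pols i] by apply: entries_incidence.
have np : (step_p st i).+1 \notin exps V st i (step_var st i).
  by apply/negP => /h4 /(_ (ltnSn _)); lia.
split.
- by move=> a; rewrite rowE; apply/pols_zero/ltnW.
- rewrite tight_rowE exps_pols => -[l hl].
  by move: np; rewrite hl mem_iota; move: h3; rewrite hl mem_iota; lia.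
- exists (step_p st i), (step_p st i + step_d st i)%N; rewrite rowE exps_pols; split.
  + by split.
  + by split=> //; lia.
  + by lia.
  + rewrite eJ; congr mon_ideal; apply/seteqP; split => x /=.
      by move=> /mapP[v vV ->]; exists (pol st i v) => //=; apply: map_f.
    by move=> [_ /= /mapP[v vV ->] <-]; apply/mapP; exists v.
Qed.

End Process.
End Polarize.

(** * Substituting powers for the new variables *)

Section Substitution.
Variable K : fieldType.

Lemma mpoly_congr N (B : comNzRingType) (J : set B)
    (f g : {rmorphism {mpoly K[N]} -> B}) : isideal J ->
  (forall c, f c%:MP = g c%:MP) -> (forall i, J (f 'X_i - g 'X_i)) ->
  forall p, J (f p - g p).
Proof.
move=> iJ fgC fgX p; rewrite [p]mpolyE !rmorph_sum -sumrB; apply: idl_sum => // m _.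
rewrite -mul_mpolyC !rmorphM fgC -mulrBr; apply: idlM => //.
rewrite mpolyXE_id !rmorph_prod.
have congM a b a' b' : J (a - b) -> J (a' - b') -> J (a * a' - b * b').
  move=> h h'; have -> : a * a' - b * b' = (a - b) * a' + b * (a' - b') by ring.
  by apply: idlD => //; [exact: idlMr|exact: idlM].
apply: (big_ind2 (fun a b => J (a - b))) => [|a b a' b'|i _].
- by rewrite subrr; apply: idl0.
- exact: congM.
- rewrite !rmorphXn; elim: (m i) => [|d IH]; first by rewrite subrr; apply: idl0.
  by rewrite !exprS; apply: congM.
Qed.

Lemma comp_mpolyX_mon N M (t : N.-tuple {mpoly K[M]}) (c : 'I_N -> 'X_{1..M}) m :
  (forall a, tnth t a = 'X_[c a]) -> 'X_[m] \mPo t = 'X_[\sum_a c a *+ m a].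
Proof.
move=> h; rewrite comp_mpolyX -mprodXnE.
by apply: eq_bigr => a _; rewrite h.
Qed.

Variables (n r : nat).
Local Notation S := {mpoly K[r + n]}.
Local Notation R := {mpoly K[n]}.

Lemma sum_var (F : 'I_(r + n) -> nat) :
  (\sum_a F a = \sum_(k < n) F (xvar r k) + \sum_(l < r) F (zvar n l))%N.
Proof.
rewrite (reindex (cast_ord (addnC n r))) /=; first by rewrite big_split_ord.
by exists (cast_ord (addnC r n)) => a _; apply: val_inj.
Qed.

Lemma split_xvar k : split (cast_ord (addnC r n) (xvar r k)) = inl k.
Proof.
have -> : cast_ord (addnC r n) (xvar r k) = lshift r k by apply: val_inj.
by rewrite -[RHS](unsplitK (inl k)).
Qed.

Lemma split_zvar l : split (cast_ord (addnC r n) (zvar n l)) = inr l.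
Proof.
have -> : cast_ord (addnC r n) (zvar n l) = rshift n l by apply: val_inj.
by rewrite -[RHS](unsplitK (inr l)).
Qed.

Section ZSubst.
Variable w : 'I_r -> R.

Lemma zsubst_x k : zsubst w 'X_(xvar r k) = 'X_k.
Proof. by rewrite /zsubst comp_mpolyXU -tnth_nth tnth_mktuple split_xvar. Qed.

Lemma zsubst_z l : zsubst w 'X_(zvar n l) = w l.
Proof. by rewrite /zsubst comp_mpolyXU -tnth_nth tnth_mktuple split_zvar. Qed.

Lemma zsubst_rmorph : {f : {rmorphism S -> R} | forall p, f p = zsubst w p}.
Proof. by eexists (comp_mpoly _) => p; reflexivity. Qed.

Lemma zsubstD p q : zsubst w (p + q) = zsubst w p + zsubst w q.
Proof. exact: rmorphD. Qed.
Lemma zsubstB p q : zsubst w (p - q) = zsubst w p - zsubst w q.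
Proof. exact: rmorphB. Qed.
Lemma zsubstM p q : zsubst w (p * q) = zsubst w p * zsubst w q.
Proof. exact: rmorphM. Qed.
Lemma zsubstXn p d : zsubst w (p ^+ d) = zsubst w p ^+ d.
Proof. exact: rmorphXn. Qed.
Lemma zsubst0 : zsubst w 0 = 0. Proof. exact: rmorph0. Qed.
Lemma zsubst1 : zsubst w 1 = 1. Proof. exact: rmorph1. Qed.

Lemma isideal_zpre (J : set R) : isideal J -> isideal [set p | J (zsubst w p)].
Proof.
move=> iJ; split=> [|a b|a b] /=; rewrite ?zsubst0 ?zsubstD ?zsubstM.
- exact: idl0.
- exact: idlD.
- exact: idlM.
Qed.

End ZSubst.

Definition xincl (p : R) : S := p \mPo [tuple 'X_(xvar r k) | k < n].

Lemma xinclX k : xincl 'X_k = 'X_(xvar r k).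
Proof. by rewrite /xincl comp_mpolyXU -tnth_nth tnth_mktuple. Qed.
Lemma xinclM p q : xincl (p * q) = xincl p * xincl q.
Proof. exact: rmorphM. Qed.
Lemma xinclXn p d : xincl (p ^+ d) = xincl p ^+ d.
Proof. exact: rmorphXn. Qed.

Lemma isideal_xpre (J : set S) : isideal J -> isideal [set p | J (xincl p)].
Proof.
move=> iJ; split=> [|a b|a b] /=.
- by rewrite /xincl rmorph0; apply: idl0.
- by rewrite /xincl rmorphD; apply: idlD.
- by rewrite xinclM; apply: idlM.
Qed.

Lemma zsubst_xincl w p : zsubst w (xincl p) = p.
Proof.
apply/eqP; rewrite -subr_eq0; apply/eqP.
have i0 : isideal [set (0 : R)].
  by split=> // [a b -> ->|a b ->]; rewrite ?addr0 ?mulr0.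
pose f : {rmorphism R -> R} := (comp_mpoly
  [tuple match split (cast_ord (addnC r n) k) with
                | inl i => 'X_i
                | inr i => w i
                end | k < r + n]) \o (comp_mpoly [tuple 'X_(xvar r k) | k < n]).
apply: (@mpoly_congr _ _ _ f idfun i0) => [c|i] /=.
  by rewrite !comp_mpolyC.
by rewrite -/(xincl _) xinclX -/(zsubst w _) zsubst_x subrr.
Qed.

Variables (j : 'I_r -> 'I_n) (e : 'I_r -> nat).

Definition zrel l : S := 'X_(zvar n l) - 'X_(xvar r (j l)) ^+ e l.
Definition zrels := [seq zrel l | l <- enum 'I_r].

Lemma size_zrels : size zrels = r.
Proof. by rewrite size_map size_enum_ord. Qed.

Lemma nth_zrels (l : 'I_r) : zrels`_l = zrel l.
Proof.
by rewrite (nth_map l) ?size_enum_ord // nth_ord_enum.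
Qed.

Lemma mem_zrels i p : p \in take i zrels -> exists2 l : 'I_r, (l < i)%N & p = zrel l.
Proof.
move=> /(nthP 0)[b]; rewrite size_take size_zrels => hb <-.
have br : (b < r)%N by move: hb; case: ifP; lia.
have bi : (b < i)%N by move: hb; case: ifP; lia.
by exists (Ordinal br) => //; rewrite nth_take // -nth_zrels.
Qed.

Lemma zrel_take i (l : 'I_r) : (l < i)%N -> zrel l \in take i zrels.
Proof.
move=> li; rewrite -nth_zrels -(nth_take 0 li); apply: mem_nth.
by rewrite size_take size_zrels; case: ifP.
Qed.

(** Reduction modulo the first [i] of the relations [z_l = x_(j l) ^ e l]. *)
Definition zred_img i (a : 'I_(r + n)) : 'X_{1..r + n} :=
  match split (cast_ord (addnC r n) a) with
  | inl k => U_(xvar r k)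
  | inr l => if (l < i)%N then U_(xvar r (j l)) *+ e l else U_(zvar n l)
  end%MM.

Definition zred i (p : S) : S := p \mPo [tuple 'X_[zred_img i a] | a < r + n].

Definition zred_mon i (m : 'X_{1..r + n}) : 'X_{1..r + n} :=
  (\sum_a zred_img i a *+ m a)%MM.

Lemma zred_X i m : zred i 'X_[m] = 'X_[zred_mon i m].
Proof. by apply: comp_mpolyX_mon => a; rewrite tnth_mktuple. Qed.

Lemma zred_img_x i k : zred_img i (xvar r k) = U_(xvar r k)%MM.
Proof. by rewrite /zred_img split_xvar. Qed.

Lemma zred_img_z i l : zred_img i (zvar n l) =
  if (l < i)%N then (U_(xvar r (j l)) *+ e l)%MM else U_(zvar n l)%MM.
Proof. by rewrite /zred_img split_zvar. Qed.

Lemma zred_var i a : zred i 'X_a = 'X_[zred_img i a].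
Proof. by rewrite /zred comp_mpolyXU -tnth_nth tnth_mktuple. Qed.

Lemma isideal_zredpre i (J : set S) : isideal J -> isideal [set p | J (zred i p)].
Proof.
move=> iJ; rewrite /zred; split=> [|a b|a b] /=; rewrite ?rmorph0 ?rmorphD ?rmorphM.
- exact: idl0.
- exact: idlD.
- exact: idlM.
Qed.

Lemma zred_zrel i l : zred i (zrel l) = if (l < i)%N then 0 else zrel l.
Proof.
rewrite /zrel /zred rmorphB rmorphXn /= -/(zred i _) -/(zred i _) !zred_var.
rewrite zred_img_x zred_img_z; case: ifP => // _.
by rewrite mpolyXn subrr.
Qed.

Lemma zred_congr i (J : set S) p : isideal J -> extl J (take i zrels) (p - zred i p).
Proof.
move=> iJ; have iE := isideal_extl (take i zrels) iJ.
apply: (@mpoly_congr _ _ _ idfun (comp_mpoly [tuple 'X_[zred_img i a] | a < r + n])) => //.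
  by move=> c /=; rewrite comp_mpolyC.
move=> a; rewrite /= -/(zred i _) zred_var; case: (varP a) => [k|l].
  by rewrite zred_img_x subrr; apply: idl0.
rewrite zred_img_z; case: ifP => li; last by rewrite subrr; apply: idl0.
by apply: extl_gen => //; rewrite -mpolyXn -/(zrel l) zrel_take.
Qed.

(** The exponents over [x_k] are compared together because the substitution merges
    them. *)
Definition over_le k (v w : 'X_{1..r + n}) :=
  (v (xvar r k) <= w (xvar r k))%N /\
  forall l, j l = k -> (v (zvar n l) <= w (zvar n l))%N.

Lemma zred_mon_x i k v w : over_le k v w ->
  (zred_mon i v (xvar r k) <= zred_mon i w (xvar r k))%N.
Proof.
move=> [hx hz]; rewrite /zred_mon !mnm_sumE !sum_var.
apply: leq_add; apply: leq_sum => a _; rewrite !mulmnE.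
  rewrite zred_img_x mnm1E (inj_eq (@xvar_inj n r)).
  by case: eqP => [->|]; rewrite ?mul0n ?mul1n.
rewrite zred_img_z; case: ifP => _; last by rewrite mnm1E eq_sym xz_neq.
rewrite mulmnE mnm1E (inj_eq (@xvar_inj n r)).
case: eqP => [ja|]; last by rewrite !mul0n.
by rewrite !mul1n leq_mul2l hz ?orbT.
Qed.

Lemma zred_mon_z (i : nat) (l : 'I_r) v : (i <= l)%N -> zred_mon i v (zvar n l) = v (zvar n l).
Proof.
move=> il; rewrite /zred_mon mnm_sumE sum_var big1 ?add0n; last first.
  by move=> k _; rewrite mulmnE zred_img_x mnm1E xz_neq.
rewrite (bigD1 l) //= big1 ?addn0.
  by rewrite mulmnE zred_img_z ltnNge il /= mnm1E eqxx mul1n.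
move=> l' l'l; rewrite mulmnE zred_img_z; case: ifP => _.
  by rewrite mulmnE mnm1E xz_neq.
by rewrite mnm1E (inj_eq (@zvar_inj n r)) (negbTE l'l).
Qed.

(** The quotient by the first [i] relations is defined by the monomials obtained from
    [W] by the partial substitution, whose exponents over each [x_k] are still
    comparable; hence [comonotone_nzd] applies to the next relation. *)
Theorem zrels_wreg (W : set 'X_{1..r + n}) :
  (forall v w k, W v -> W w -> over_le k v w \/ over_le k w v) ->
  wreg (mon_ideal (K := K) W) zrels.
Proof.
move=> hW; apply/wregP => i; rewrite size_zrels => ir.
set l := Ordinal ir; rewrite -[i]/(nat_of_ord l) nth_zrels /=.
have iW := isideal_mon K W.
pose M := mon_ideal (K := K) (zred_mon i @` W).
have iM : isideal M by apply: isideal_mon.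
have EM : extl (mon_ideal W) (take i zrels) `<=` [set p | M (zred i p)].
  apply: extl_min; first exact: isideal_zredpre.
    apply: ideal_gen_min; first exact: isideal_zredpre.
    move=> _ [v Wv <-]; rewrite /= zred_X; apply/mon_idealX.
    by exists (zred_mon i v); [exists v|apply: lepm_refl].
  by move=> p /mem_zrels[l' l'i ->]; rewrite /= zred_zrel l'i; apply: idl0.
have iE := isideal_extl (take i zrels) iW.
have ME : M `<=` extl (mon_ideal W) (take i zrels).
  apply: ideal_gen_min => // _ [_ [v Wv <-] <-].
  rewrite -zred_X -(subKr 'X_[v] (zred i _)); apply: idlB => //.
    by apply: sub_extl; apply/mon_idealX; exists v => //; apply: lepm_refl.
  exact: zred_congr.
move=> F /EM; rewrite /= /zred rmorphM /= -/(zred i _) -/(zred i F) zred_zrel ltnn => h.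
rewrite -(subrK (zred i F) F); apply: idlD => //; first exact: zred_congr.
apply: ME; move: h; apply: comonotone_nzd.
  by rewrite eq_sym xz_neq.
move=> _ _ [v Wv <-] [w Ww <-] lt; rewrite !zred_mon_z //.
have [[_ hz]|/(zred_mon_x i)] := hW v w (j l) Wv Ww; first exact: hz.
by rewrite leqNgt lt.
Qed.

Definition zcollapse (m : 'X_{1..r + n}) : 'X_{1..n} :=
  [multinom (m (xvar r k) + \sum_(l < r | j l == k) e l * m (zvar n l))%N | k < n].

Lemma zsubst_X m : zsubst (fun l => 'X_(j l) ^+ e l) 'X_[m] = 'X_[K, zcollapse m].
Proof.
pose c (a : 'I_(r + n)) : 'X_{1..n} := match split (cast_ord (addnC r n) a) with
  | inl k => U_(k) | inr l => U_(j l) *+ e l end%MM.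
rewrite /zsubst (@comp_mpolyX_mon _ _ _ c); last first.
  by move=> a; rewrite tnth_mktuple /c; case: split => // l; rewrite mpolyXn.
congr mpolyX; apply/mnmP => k; rewrite mnm_sumE mnmE sum_var; congr (_ + _)%N.
  rewrite (bigD1 k) //= big1 ?addn0.
    by rewrite /c split_xvar mulmnE mnm1E eqxx mul1n.
  by move=> k' k'k; rewrite /c split_xvar mulmnE mnm1E (negbTE k'k).
rewrite [RHS]big_mkcond; apply: eq_bigr => l _.
rewrite /c split_zvar !mulmnE mnm1E; case: eqP => _; by rewrite ?mul1n.
Qed.

Lemma zsubst_zrel l : zsubst (fun l => 'X_(j l) ^+ e l) (zrel l) = 0.
Proof. by rewrite zsubstB zsubst_z zsubstXn zsubst_x subrr. Qed.

(** The relations say precisely that [z_l] may be replaced by its image. *)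
Lemma xincl_congr (J : set S) p : isideal J ->
  extl J zrels (p - xincl (zsubst (fun l => 'X_(j l) ^+ e l) p)).
Proof.
move=> iJ; have iE := isideal_extl zrels iJ.
pose f : {rmorphism S -> S} := (comp_mpoly [tuple 'X_(xvar r k) | k < n]) \o (comp_mpoly
  [tuple match split (cast_ord (addnC r n) k) with
                | inl i => 'X_i
                | inr i => 'X_(j i) ^+ e i
                end | k < r + n]).
apply: (@mpoly_congr _ _ _ idfun f iE) => [c|a] /=.
  by rewrite !comp_mpolyC.
rewrite -/(zsubst (fun l => 'X_(j l) ^+ e l) _) -/(xincl _); case: (varP a) => [k|l].
  by rewrite zsubst_x xinclX subrr; apply: idl0.
rewrite zsubst_z xinclXn xinclX; apply: extl_gen => //.
by apply: (map_f zrel); rewrite mem_enum.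
Qed.

(** Modulo the relations every polynomial agrees with its image under the
    substitution, so only the images of the generators remain. *)
Lemma zsubst_ker (W : set 'X_{1..r + n}) (p : S) :
  mon_ideal (zcollapse @` W) (zsubst (fun l => 'X_(j l) ^+ e l) p) <->
  extl (mon_ideal W) zrels p.
Proof.
set w := (fun l => _); have iW := isideal_mon K W.
have iL := isideal_mon K (zcollapse @` W).
have iE := isideal_extl zrels iW; split=> [h|].
  rewrite -(subrK (xincl (zsubst w p)) p); apply: idlD => //; first exact: xincl_congr.
  suff H : mon_ideal (zcollapse @` W) `<=` [set q | extl (mon_ideal W) zrels (xincl q)] by apply: H.
  apply: ideal_gen_min; first exact: isideal_xpre.
  move=> _ [_ [v Wv <-] <-]; rewrite /= -zsubst_X -(subKr 'X_[v] (xincl _)).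
  apply: idlB => //; last exact: xincl_congr.
  by apply: sub_extl; apply/mon_idealX; exists v => //; apply: lepm_refl.
move: p; apply: extl_min; first exact: isideal_zpre.
  apply: ideal_gen_min; first exact: isideal_zpre.
  move=> _ [v Wv <-]; rewrite /= zsubst_X; apply/mon_idealX.
  by exists (zcollapse v); [exists v|apply: lepm_refl].
by move=> _ /mapP[l _ ->] /=; rewrite zsubst_zrel; apply: idl0.
Qed.

Lemma zsubst_image (W : set 'X_{1..r + n}) :
  ideal_gen (zsubst (fun l => 'X_(j l) ^+ e l) @` mon_ideal (K := K) W) =
  mon_ideal (zcollapse @` W).
Proof.
apply/seteqP; split; apply: ideal_gen_min; try exact: isideal_gen.
  move=> _ [p Wp <-]; apply/zsubst_ker; exact: sub_extl.
move=> _ [_ [v Wv <-] <-]; rewrite -zsubst_X; apply: sub_ideal_gen.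
by exists 'X_[v] => //; apply/mon_idealX; exists v => //; apply: lepm_refl.
Qed.

End Substitution.

(** * Regular sequences and quotients *)

Lemma surj_rmorph_iso (A B C : comNzRingType) (f : {rmorphism A -> B})
    (g : {rmorphism A -> C}) :
  (forall b, exists a, f a = b) -> (forall c, exists a, g a = c) ->
  (forall a, f a = 0 <-> g a = 0) ->
  exists2 phi : {rmorphism B -> C}, bijective phi & forall a, phi (f a) = g a.
Proof.
move=> /choice[s sK] /choice[t tK] ker.
have fg a b : f a = f b <-> g a = g b.
  split=> /eqP; rewrite -subr_eq0 -rmorphB => /eqP /ker /eqP;
  by rewrite rmorphB subr_eq0 => /eqP.
pose phi b := g (s b).
have phiE a : phi (f a) = g a by apply/fg; rewrite sK.
have phiB : zmod_morphism phi.
  by move=> x y; rewrite -(sK x) -(sK y) -rmorphB !phiE rmorphB.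
have phiM : monoid_morphism phi.
  split; first by rewrite -(rmorph1 f) phiE rmorph1.
  by move=> x y; rewrite -(sK x) -(sK y) -rmorphM !phiE rmorphM.
pose m1 := GRing.isZmodMorphism.Build B C phi phiB.
pose m2 := GRing.isMonoidMorphism.Build B C phi phiM.
pose F : {rmorphism B -> C} := HB.pack phi m1 m2.
exists F; last exact: phiE.
exists (fun c => f (t c)) => x; last by rewrite /= phiE tK.
by rewrite -[RHS]sK; apply/fg; rewrite tK.
Qed.

Section Irrelevant.
Variable K : fieldType.

Definition irrelevant N : set {mpoly K[N]} := ideal_gen (range (fun i : 'I_N => 'X_i)).

Lemma irrelevant_ideal N : isideal (@irrelevant N).
Proof. exact: isideal_gen. Qed.

Lemma irrelevantX N i : @irrelevant N 'X_i.
Proof. by apply: sub_ideal_gen; exists i. Qed.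

Lemma irrelevant1 N : ~ @irrelevant N 1.
Proof.
have sub : @irrelevant N `<=` [set p | p@_0%MM = 0].
  apply: ideal_gen_min => [|_ [i _ <-]] /=; last first.
    by rewrite mcoeffX; case: eqP => // /eqP; rewrite mnm1_eq0.
  split=> [|a b|a b] /=; first by rewrite mcoeff0.
    by rewrite mcoeffD => -> ->; rewrite addr0.
  by move=> hb; rewrite (rmorphM (mcoeff (n := N) 0%MM)) /= hb mulr0.
by move=> /sub /=; rewrite mcoeff1 eqxx => /eqP; rewrite oner_eq0.
Qed.

Lemma mon_ideal_irrelevant N (W : set 'X_{1..N}) : ~ W 0%MM ->
  mon_ideal W `<=` @irrelevant N.
Proof.
move=> W0; apply: ideal_gen_min; first exact: irrelevant_ideal.
move=> _ [v Wv <-]; have [i vi] : exists i, v i != 0%N.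
  apply: contrapT => no; apply: W0; suff <- : v = 0%MM by [].
  apply/mnmP => i; rewrite mnm0E; apply/eqP/negPn/negP => vi; apply: no.
  by exists i.
by apply: monomial_in_ideal vi; [exact: irrelevant_ideal|exact: irrelevantX].
Qed.

Lemma depth_seqP N (I : idealr {mpoly K[N]}) W s : [set` I] = mon_ideal W ->
  depth_seq I s <-> (forall a, a \in s -> irrelevant a) /\ wreg (mon_ideal W) s.
Proof.
move=> eI; split=> [[/quot_regular_seqP[]]|[sm ws]]; first by rewrite eI.
split=> //; apply/quot_regular_seqP; rewrite eI; split => // h1.
apply: (@irrelevant1 N); move: h1; apply: extl_min => //; first exact: irrelevant_ideal.
by apply: mon_ideal_irrelevant; apply: mon_idealr_n0 eI.
Qed.

End Irrelevant.

Section Transfer.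
Variables (K : fieldType) (n r : nat) (j : 'I_r -> 'I_n) (e : 'I_r -> nat).
Variables (I : idealr {mpoly K[n]}) (J : idealr {mpoly K[r + n]}).
Variable W : set 'X_{1..r + n}.
Hypothesis JW : [set` J] = mon_ideal W.
Hypothesis IW : [set` I] = mon_ideal (zcollapse j e @` W).

Local Notation w := (fun l => 'X_(j l) ^+ e l).

Lemma zrels_proper : ~ extl [set` J] (zrels K j e) 1.
Proof.
by rewrite JW => /zsubst_ker; rewrite zsubst1 -IW /= idealr1.
Qed.

Lemma quotient_iso_zrels : quotient_iso J (zrels K j e) I w.
Proof.
pose Q := {ideal_quot J}.
have [|F eF] := ex_idealr (isideal_gen [set` [seq \pi_Q a | a <- zrels K j e]]).
  by rewrite -(rmorph1 (\pi_Q : {rmorphism _ -> Q})) => /ideal_gen_pi; apply: zrels_proper.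
exists F => //; pose QF := {ideal_quot F}; pose QI := {ideal_quot I}.
pose f : {rmorphism {mpoly K[r + n]} -> QF} :=
  (\pi_QF : {rmorphism Q -> QF}) \o (\pi_Q : {rmorphism _ -> Q}).
have [z zE] := @zsubst_rmorph K n r w.
pose g : {rmorphism {mpoly K[r + n]} -> QI} := (\pi_QI : {rmorphism _ -> QI}) \o z.
have [|||phi phib phiE] := @surj_rmorph_iso _ _ _ f g.
- by move=> q; exists (repr (repr q)); rewrite /= !reprK.
- by move=> q; exists (xincl r (repr q)); rewrite /= zE zsubst_xincl reprK.
- move=> p; rewrite /f /g /= pi0 eF ideal_gen_pi pi0 zE JW IW.
  by rewrite zsubst_ker.
by exists phi => // p; have := phiE p; rewrite /= zE.
Qed.

(** Regular sequences and killed classes over [I] lift behind the relations. *)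
Lemma extl_xincl s p : extl [set` J] (zrels K j e ++ [seq xincl r a | a <- s]) p <->
  extl [set` I] s (zsubst w p).
Proof.
have iJ := isideal_idealr J; have iI := isideal_idealr I.
rewrite extl_cat; split.
  move: p; apply: extl_min; first exact/isideal_zpre/isideal_extl.
    by move=> p; rewrite JW => /zsubst_ker; rewrite -IW; apply: sub_extl.
  by move=> _ /mapP[a sa ->] /=; rewrite zsubst_xincl; apply: extl_gen.
move=> h; have iE := isideal_extl (zrels K j e) iJ.
rewrite -(subrK (xincl r (zsubst w p)) p); apply: idlD; first exact: isideal_extl.
  by apply: sub_extl; apply: xincl_congr.
move: (zsubst w p) h; apply: extl_min; first exact/isideal_xpre/isideal_extl.
  move=> q Iq /=; apply: sub_extl; rewrite JW; apply/zsubst_ker.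
  by rewrite zsubst_xincl -IW.
by move=> a sa /=; apply: extl_gen => //; apply: map_f.
Qed.

Hypothesis e_gt0 : forall l, (0 < e l)%N.
Hypothesis Wreg : wreg [set` J] (zrels K j e).

Lemma zrel_irrelevant l : irrelevant (zrel K j e l).
Proof.
have iM := irrelevant_ideal K (r + n).
apply: idlB => //; first exact: irrelevantX.
by rewrite -(prednK (e_gt0 l)) exprS; apply: idlMr => //; apply: irrelevantX.
Qed.

Lemma xincl_irrelevant (a : {mpoly K[n]}) : irrelevant a -> irrelevant (xincl r a).
Proof.
move: a; apply: ideal_gen_min; first exact/isideal_xpre/irrelevant_ideal.
by move=> _ [k _ <-] /=; rewrite xinclX; apply: irrelevantX.
Qed.

Lemma zsubst_irrelevant (p : {mpoly K[r + n]}) : irrelevant p -> irrelevant (zsubst w p).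
Proof.
move: p; apply: ideal_gen_min; first exact/isideal_zpre/irrelevant_ideal.
move=> _ [a _ <-] /=; case: (varP a) => [k|l].
  by rewrite zsubst_x; apply: irrelevantX.
rewrite zsubst_z -(prednK (e_gt0 l)) exprS; apply: idlMr; first exact: irrelevant_ideal.
exact: irrelevantX.
Qed.

(** A longest regular sequence on [R / I] is lifted behind the relations; the class
    killed by the irrelevant ideal that it leaves makes [depth_bound] applicable. *)
Theorem depth_transfer : exists d, quot_depth I d /\ quot_depth J (d + r).
Proof.
have iI := isideal_idealr I; have iJ := isideal_idealr J.
have bound s : depth_seq I s -> (size s <= n)%N.
  move=> [/quot_regular_seqP[ws s1] _].
  have := indep_bound (C := finset.set0) iI _ (wreg_nz_chain iI ws s1).
  rewrite finset.setC0 cardsT card_ord; apply.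
  by apply: var_set_min => // i; rewrite finset.in_set0.
pose P d := `[< exists2 s, depth_seq I s & size s = d >].
have exP : exists d, P d.
  exists 0%N; apply/asboolP; exists [::] => //.
  by apply/(depth_seqP _ IW); split.
have bP d : P d -> (d <= n)%N by move=> /asboolP[s hs <-]; apply: bound.
case: (ex_maxnP exP bP) => d /asboolP[s hs sd] maxd; exists d.
have dI : quot_depth I d.
  by split; [exists s|move=> t ht; apply: maxd; apply/asboolP; exists t].
split=> //; have [sm ws] := (depth_seqP s IW).1 hs; rewrite -IW in ws.
have [|u [us um]] := @ex_socle _ (@noetherian_mpoly K n) (@irrelevant K n) (extl [set` I] s)
  (irrelevant_ideal K n) (isideal_extl s iI).
  move=> a ma na; have : (d.+1 <= d)%N; last by rewrite ltnn.
  apply: maxd; apply/asboolP; exists (rcons s a); last by rewrite size_rcons sd.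
  apply/(depth_seqP _ IW); split=> [b|].
    by rewrite mem_rcons inE => /orP[/eqP->|/sm].
  by rewrite -IW -cats1 wreg_cat; split=> //=.
pose xs := zrels K j e ++ map (@xincl K n r) s.
have xsm (a : {mpoly K[r + n]}) : a \in xs -> irrelevant a.
  rewrite mem_cat => /orP[/mapP[l _ ->]|/mapP[b bs ->]]; first exact: zrel_irrelevant.
  exact/xincl_irrelevant/sm.
have wxs : wreg [set` J] xs.
  apply/wreg_cat; split => //; apply/wregP => i; rewrite size_map => is_ a.
  rewrite (nth_map 0) // -map_take -!extl_cat !extl_xincl zsubstM zsubst_xincl.
  by move/wregP: ws; apply.
have szxs : size xs = (d + r)%N by rewrite size_cat size_zrels size_map sd addnC.
split; first by exists xs => //; apply/(depth_seqP _ JW); rewrite -JW.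
move=> ys /(depth_seqP _ JW)[ysm wys]; rewrite -szxs; rewrite -JW in wys.
have soc : socle_at (@irrelevant K (r + n)) (extl [set` J] xs) (xincl r u).
  split; first by rewrite extl_xincl zsubst_xincl.
  move=> a ma; rewrite extl_xincl zsubstM zsubst_xincl; apply: um.
  exact: zsubst_irrelevant.
exact: (depth_bound (@noetherian_mpoly K (r + n)) (irrelevant_ideal K (r + n)) iJ
  xsm wxs soc ysm wys).
Qed.

End Transfer.

Lemma zrels_regular (K : fieldType) n r (j : 'I_r -> 'I_n) (e : 'I_r -> nat) :
  (forall l, (0 < e l)%N) -> regular_seq (zrels K j e).
Proof.
move=> e0; have E0 : mon_ideal set0 = [set (0 : {mpoly K[r + n]})].
  apply/seteqP; split; last by move=> _ ->; apply: idl0; apply: isideal_gen.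
  apply: ideal_gen_min => [|_ [v []]].
  by split=> // [a b -> ->|a b ->]; rewrite ?addr0 ?mulr0.
have : wreg (mon_ideal set0) (zrels K j e) by apply: zrels_wreg.
rewrite E0 => /wregP h; split.
  by move=> i a is_; rewrite !ideal_gen_extl; apply: h.
move=> hT; apply: (@irrelevant1 K (r + n)).
have : ideal_gen [set` zrels K j e] 1 by rewrite hT.
apply: ideal_gen_min; first exact: irrelevant_ideal.
by move=> _ /= /mapP[l _ ->]; apply: zrel_irrelevant.
Qed.

(** * Signatures and covers of the polarization *)

Section Signature.
Variables (n : nat) (V : seq 'X_{1..n}).

Definition sgn_mon (v : 'X_{1..n}) : 'X_{1..n} :=
  [multinom index (v k) (sort leq (undup [seq fun_of_multinom u k | u <- V])) | k < n].

Lemma range_sgn_mx :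
  range (fun j => [multinom sgn_mx (incidence_mx V) i j | i < n]) =
  [set` [seq sgn_mon v | v <- V]].
Proof.
have colE j : [multinom sgn_mx (incidence_mx V) i j | i < n] =
    sgn_mon (tnth (in_tuple V) j).
  apply/mnmP => k; rewrite !mnmE /sgn_mx !mxE; congr (index _ (sort leq (undup _))).
  exact: entries_incidence.
apply/seteqP; split => x /=.
  by move=> [j _ <-]; rewrite colE; apply: map_f; apply: mem_tnth.
move=> /mapP[v vV ->].
have [j ->] : exists j, v = tnth (in_tuple V) j by apply/tnthP.
by exists j.
Qed.

End Signature.

Section Covers.
Variables (n r : nat) (V : seq 'X_{1..n}) (st : nat -> 'I_n * (nat * nat)).
Hypothesis validst : forall i, (i < r)%N -> valid V st i.
Local Notation j := (fun l : 'I_r => step_var st l).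

(** Every variable of a cover is replaced by the [x_k] over which it lies. *)
Lemma cover_pols_le (D : {set 'I_(r + n)}) : vertex_cover [set` pols V st r] D ->
  exists2 C, vertex_cover [set` V] C & (#|C| <= #|D|)%N.
Proof.
pose f (a : 'I_(r + n)) := match split (cast_ord (addnC r n) a) with
  | inl k => k | inr l => j l end.
move=> cD; exists (imset f (mem D)); last exact: leq_imset_card.
move=> v /= vV; have /cD /offPn[a aD va] : pol st r v \in pols V st r by apply: map_f.
apply/offPn; exists (f a); first exact: imset_f.
apply: contra va => /eqP; rewrite /f; case: (varP a) => [k|l].
  by rewrite split_xvar pol_x => vk; have [-> _] := xexp0 validst (leqnn r) vV vk.
rewrite split_zvar pol_z /zexp => vk.
by have [-> _] := xexp0 validst (ltnW (ltn_ord l)) vV vk.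
Qed.

(** The least positive exponent of [x_k] leaves a trace in some variable lying
    over [x_k]; by monotonicity so do all the larger ones. *)
Lemma ex_cover_var k : exists a : 'I_(r + n),
  forall v, v \in V -> v k != 0%N -> pol st r v a != 0%N.
Proof.
have [[v0 v0V v0k]|no] := pselect (exists2 v, v \in V & v k != 0%N); last first.
  by exists (xvar r k) => v vV vk; case: no; exists v.
have ex : exists q, has (fun v : 'X_{1..n} => (v k == q) && (v k != 0%N)) V.
  by exists (v0 k); apply/hasP; exists v0; rewrite // eqxx.
case: (ex_minnP ex) => q /hasP[v1 v1V /andP[/eqP v1q v1k]] minq.
have le1 v : v \in V -> v k != 0%N -> (v1 k <= v k)%N.
  by move=> vV vk; rewrite v1q; apply: minq; apply/hasP; exists v; rewrite // eqxx.
have := xexp_sum validst k (leqnn r) v1V.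
have [x0|x0] := eqVneq (xexp st r v1 k) 0%N; last first.
  move=> _; exists (xvar r k) => v vV vk; rewrite pol_x -lt0n.
  by apply: leq_trans (xexp_mono validst (leqnn r) v1V vV (le1 v vV vk)); rewrite lt0n.
rewrite x0 add0n => e.
have [l jl zl] : exists2 l : 'I_r, j l = k & zexp st l v1 != 0%N.
  apply: contrapT => no; move: v1k; rewrite -e big1 ?eqxx // => l /eqP jl.
  have [->|zl] := eqVneq (zexp st l v1) 0%N; first by rewrite muln0.
  by case: no; exists l.
exists (zvar n l) => v vV vk; rewrite pol_z -lt0n.
have vk1 : (v1 (step_var st l) <= v (step_var st l))%N by rewrite jl le1.
by apply: leq_trans (zexp_mono validst (ltn_ord l) v1V vV vk1); rewrite lt0n.
Qed.

Lemma cover_pols_ge C : vertex_cover [set` V] C ->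
  exists2 D : {set 'I_(r + n)}, vertex_cover [set` pols V st r] D & (#|D| <= #|C|)%N.
Proof.
have [f hf] := choice ex_cover_var.
move=> cC; exists (imset f (mem C)); last exact: leq_imset_card.
move=> _ /= /mapP[v vV ->]; have /offPn[k kC vk] := cC v vV.
by apply/offPn; exists (f k); [exact: imset_f|exact: hf].
Qed.

Lemma pols_over_le v w k : v \in pols V st r -> w \in pols V st r ->
  over_le j k v w \/ over_le j k w v.
Proof.
have mono v' w' : v' \in V -> w' \in V -> (v' k <= w' k)%N ->
    over_le j k (pol st r v') (pol st r w').
  move=> vV wV le; split; first by rewrite !pol_x; apply: (xexp_mono validst).
  by move=> l jl; rewrite !pol_z; apply: (zexp_mono validst) => //; rewrite jl.
move=> /mapP[v' v'V ->] /mapP[w' w'V ->].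
by case/orP: (leq_total (v' k) (w' k)) => le; [left|right]; apply: mono.
Qed.

Lemma zcollapse_pol v : v \in V ->
  zcollapse j (fun l => step_d st l) (pol st r v) = v.
Proof.
move=> vV; apply/mnmP => k; rewrite mnmE pol_x -[RHS](xexp_sum validst k (leqnn r) vV).
by congr (_ + _)%N; apply: eq_bigr => l _; rewrite pol_z.
Qed.

Lemma zcollapse_pol1 v : (forall k, tight_row (exps V st r k)) ->
  (forall k, exists2 v, v \in V & v k = 0%N) -> v \in V ->
  zcollapse j (fun=> 1%N) (pol st r v) = sgn_mon V v.
Proof.
move=> tight zero vV; apply/mnmP => k; rewrite !mnmE.
rewrite -(shift_rank validst (tight k) (zero k) vV) pol_x; congr (_ + _)%N.
by apply: eq_bigr => l _; rewrite pol_z mul1n.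
Qed.

Lemma sgn_mon_eq0 v k : (forall k, tight_row (exps V st r k)) ->
  (forall k, exists2 v, v \in V & v k = 0%N) -> v \in V ->
  (sgn_mon V v k == 0%N) = (v k == 0%N).
Proof.
move=> tight zero vV.
rewrite mnmE -(shift_rank validst (tight k) (zero k) vV).
apply/idP/idP => [|/eqP vk]; last by have [-> ->] := xexp0 validst (leqnn r) vV vk.
rewrite addn_eq0 /zcount sum_nat_eq0 => /andP[/eqP x0 /forallP z0].
rewrite -(xexp_sum validst k (leqnn r) vV) x0 add0n sum_nat_eq0; apply/forallP => l.
apply/implyP => jl; have /implyP/(_ jl)/eqP -> := z0 l.
by rewrite muln0.
Qed.

End Covers.

Theorem proposition2p8 (K : fieldType) (n : nat) (I : idealr {mpoly K[n]})
    (h : nat) (monI : monomial_ideal I) (htI : height I h) (h_ge2 : (2 <= h)%N) :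
  exists (sgnI : idealr {mpoly K[n]}) (r : nat) (j : 'I_r -> 'I_n)
         (d : 'I_r -> nat) (Ipol : idealr {mpoly K[r + n]}),
  let f := [seq 'X_(zvar n i) - 'X_(xvar r (j i)) ^+ d i | i <- enum 'I_r]
             : seq {mpoly K[r + n]} in
  let g := [seq 'X_(zvar n i) - 'X_(xvar r (j i)) | i <- enum 'I_r]
             : seq {mpoly K[r + n]} in
  is_signature I [set` sgnI] /\
  full_weighted_polarization I j d Ipol /\
  [/\ (forall i, (2 <= d i)%N) /\ regular_seq f /\ regular_seq g,
      quot_regular_seq Ipol f /\ quot_regular_seq Ipol g,
      quotient_iso Ipol f I (fun i => 'X_(j i) ^+ d i) /\
      quotient_iso Ipol g sgnI (fun i => 'X_(j i)),
      height I h /\ height Ipol h /\ height sgnI h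
    & (exists e : nat, krull_dim {ideal_quot I} e /\
                       krull_dim {ideal_quot Ipol} (e + r)) /\
      (exists e : nat, quot_depth I e /\ quot_depth Ipol (e + r))].
Proof.
have [V minV] := ex_min_gens monI.
have [uV eI aV] := (min_gens_antichain I V).1 minV.
have V0 : 0%MM \notin V by apply/negP; exact: (mon_idealr_n0 eI).
have [C [cC hC] minC] := height_coverP eI htI.
(* a row without zero entry would be a cover of size one *)
have zero k : exists2 v, v \in V & v k = 0%N.
  apply: contrapT => no; have : (h <= #|finset.set1 k|)%N.
    apply: minC => v vV; apply/offPn; exists k; first exact: finset.set11.
    by apply/eqP => vk; apply: no; exists v.
  by rewrite cards1 leqNgt h_ge2.
have [k0 _] : exists k0, k0 \in C.
  by apply/card_gt0P; rewrite hC ltnW.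
have [st [r [validst tight]]] := ex_full_steps k0 zero.
pose j (l : 'I_r) := step_var st l.
pose d (l : 'I_r) := step_d st l.
have d2 l : (2 <= d l)%N by have [_ + _ _] := validst l (ltn_ord l).
have sgn0 : 0%MM \notin [seq sgn_mon V v | v <- V].
  apply/negP => /mapP[v vV /esym e]; move: V0; suff <- : v = 0%MM by rewrite vV.
  apply/mnmP => k; apply/eqP; rewrite mnm0E -(sgn_mon_eq0 validst k tight zero vV).
  by rewrite e mnm0E.
pose sgnI := mon_idealr K sgn0.
pose P i := mon_idealr K (pols_n0 st i V0).
pose Ipol := P r.
have eP : [set` Ipol] = mon_ideal [set` pols V st r] by apply: mon_idealrE.
have eS : [set` sgnI] = mon_ideal [set` [seq sgn_mon V v | v <- V]] by apply: mon_idealrE.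
have eId : [set` I] = mon_ideal (zcollapse j d @` [set` pols V st r]).
  rewrite eI; congr mon_ideal; apply/seteqP; split => x /=.
    move=> xV; exists (pol st r x); [exact: map_f|exact: (zcollapse_pol validst)].
  by move=> [_ /= /mapP[v vV ->] <-]; rewrite (zcollapse_pol validst).
have eS1 : [set` sgnI] = mon_ideal (zcollapse j (fun=> 1%N) @` [set` pols V st r]).
  rewrite eS; congr mon_ideal; apply/seteqP; split => x /=.
    move=> /mapP[v vV ->]; exists (pol st r v); first exact: map_f.
    exact: (zcollapse_pol1 validst).
  by move=> [_ /= /mapP[v vV ->] <-]; rewrite (zcollapse_pol1 validst) //; apply: map_f.
have wr e : wreg [set` Ipol] (zrels K j e).
  by rewrite eP; apply: zrels_wreg => v w k; apply: pols_over_le.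
exists sgnI, r, j, d, Ipol => f g.
have fE : f = zrels K j d by [].
have gE : g = zrels K j (fun=> 1%N) by [].
have sgnE : is_signature I [set` sgnI] by exists V; rewrite ?range_sgn_mx.
have hs : height sgnI h.
  have covE D : vertex_cover [set` [seq sgn_mon V v | v <- V]] D <-> vertex_cover [set` V] D.
    split=> cD v /= vV.
      have /cD /offPn[k kD] : sgn_mon V v \in [seq sgn_mon V v | v <- V] by apply: map_f.
      by rewrite (sgn_mon_eq0 validst) // => vk; apply/offPn; exists k.
    move: vV => /mapP[u Vu ->]; have /offPn[k kD uk] := cD u Vu.
    by apply/offPn; exists k; rewrite // (sgn_mon_eq0 validst).
  rewrite -hC; apply: (height_cover eS); first exact/covE.
  by move=> D /covE; rewrite hC; apply: minC.
have [D cD hD] : exists2 D : {set 'I_(r + n)}, vertex_cover [set` pols V st r] D & #|D| = h.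
  have [D cD DC] := cover_pols_ge validst cC; exists D => //.
  have [C' cC' hC'] := cover_pols_le validst cD.
  by apply/eqP; rewrite eqn_leq -{1}hC DC (leq_trans (minC _ cC')).
have minD D' : vertex_cover [set` pols V st r] D' -> (#|D| <= #|D'|)%N.
  by move=> /(cover_pols_le validst)[C' cC' le]; rewrite hD (leq_trans (minC _ cC')).
have minC' C' : vertex_cover [set` V] C' -> (#|C| <= #|C'|)%N by rewrite hC; apply: minC.
rewrite fE gE; split=> //; split.
  split.
    exists P; split=> // [x|i].
      have e : [set` P 0%N] = [set` I].
        by rewrite mon_idealrE eI -[pols V st 0]/([seq id v | v <- V]) map_id.
      by move/seteqP: e => [e1 e2]; apply/idP/idP => [/e1|/e2].
    by apply: (pols_step validst) => //; apply: mon_idealrE.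
  have -> : (fun i => 'X_(j i)) = (fun i => 'X_(j i) ^+ (fun=> 1%N) i) :> ('I_r -> {mpoly K[n]}).
    by [].
  by rewrite eP zsubst_image -eS1.
split.
- by split=> //; split; apply: zrels_regular => // l; apply: ltnW.
- by split; apply/quot_regular_seqP; split; [exact: wr|exact: (zrels_proper eP eId)|
    exact: wr|exact: (zrels_proper eP eS1)].
- split; first exact: (quotient_iso_zrels eP eId).
  exact: (quotient_iso_zrels eP eS1).
- by split=> //; split=> //; rewrite -hD; apply: (height_cover eP).
- split; last by apply: (depth_transfer eP eId) => // l; apply: ltnW.
  exists (n - h)%N; split; first by rewrite -hC; apply: (krull_dim_cover eI).
  have -> : (n - h + r = r + n - #|D|)%N.
    have : (h <= n)%N by rewrite -hC; apply: leq_trans (max_card _) _; rewrite card_ord.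
    by rewrite hD; lia.
  exact: (krull_dim_cover eP).
Qed.
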